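(* Let $(M,\mathbf g)$ be a spacetime with a locally anti-Lipschitz time function $\tau$. Let $\hat{\mathcal A}$ be the set of piecewise causal paths in $M$ and $\hat L_\tau$ the null length. Then $(M,\hat{\mathcal A},\hat L_\tau)$ defines a length structure on $M$, i.e., $\hat{\mathcal A}$ is an admissible class of paths and: (i) the length of paths is additive: $\hat L_\tau(\beta|_{[a,b]})=\hat L_\tau(\beta|_{[a,c]})+\hat L_\tau(\beta|_{[c,b]})$ for any $\beta\in\hat{\mathcal A}$, $\beta:[a,b]\to M$, and any $c\in[a,b]$; (ii) the length of a piece of a path depends continuously on the piece: for a fixed path $\beta:[a,b]\to M$ in $\hat{\mathcal A}$ the function $t\mapsto \hat L_\tau(\beta|_{[a,t]})$ is continuous; (iii) the length is invariant under reparametrizations: $\hat L_\tau(\beta\circ\varphi)=\hat L_\tau(\beta)$ for any diffeomorphism $\varphi$ such that $\beta,\beta\circ\varphi\in\hat{\mathcal A}$; (iv) the length structure agrees with the topology: for every $p\in M$ and every neighborhood $U_p$ of $p$, $\inf\{\hat L_\tau(\beta) : \beta\in\hat{\mathcal A},\ \beta(a)=p,\ \beta(b)\in M\setminus U_p\}>0$. Thus $\hat d_\tau$ is the intrinsic metric of $M$ with respect to this length structure, and hence $(M,\hat d_\tau)$ is a length space.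
   Context: A spacetime $(M,\mathbf g)$ is a connected, time-oriented Lorentzian manifold (second countable, Hausdorff, signature $(-,+,\dots,+)$). We write $p\le q$ if $p=q$ or there is a future-directed causal curve from $p$ to $q$. A time function is a continuous function $\tau:M\to\mathbb R$ that is strictly increasing along future-directed causal curves. A piecewise causal curve (path) is a continuous, piecewise smooth curve $\beta:[a,b]\to M$ for which there is a partition $a=s_0<s_1<\dots<s_k=b$ such that on each piece $[s_{i-1},s_i]$ the curve is smooth and either future-directed causal or past-directed causal. Its null length is $\hat L_\tau(\beta)=\sum_{i=1}^k|\tau(\beta(s_i))-\tau(\beta(s_{i-1}))|$. The null distance is $\hat d_\tau(p,q)=\inf\{\hat L_\tau(\beta):\beta \text{ a piecewise causal curve from } p \text{ to } q\}$ (any two points of a spacetime are joined by a piecewise causal curve). A function $f:M\to\mathbb R$ is anti-Lipschitz on $U\subseteq M$ if there is a (definite) distance function $d_U$ on $U$ such that for all $p,q\in U$: $p\le q\Rightarrow f(q)-f(p)\ge d_U(p,q)$. It is locally anti-Lipschitz if every point of $M$ has a neighborhood $U$ on which $f$ is anti-Lipschitz. A class of paths is admissible if it is closed under restrictions to subintervals, concatenations, and (smooth) reparametrizations. The intrinsic metric of a length structure is the infimum of lengths of admissible paths joining two points; a length space is a metric space whose metric is the intrinsic metric of a length structure. *)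

(* Defs.v *)
From HB Require Import structures.
From mathcomp Require Import all_boot all_order all_algebra.
From mathcomp Require Import all_classical all_reals all_analysis.
From mathcomp Require Import ring lra.

Set Implicit Arguments.
Unset Strict Implicit.
Unset Printing Implicit Defensive.

Import Order.TTheory GRing.Theory Num.Theory.
Import numFieldNormedType.Exports.

Local Open Scope classical_set_scope.
Local Open Scope ring_scope.

Section smoothness.
Context {R : realType}.

(* On an open subset U of a finite-dimensional space: all iterated directional
   derivatives of order at most k exist and are continuous on U. *)
Fixpoint Ck {V W : normedModType R} (k : nat) (U : set V) (f : V -> W) : Prop :=
  {in U, continuous f} /\
  if k is k'.+1 then
    forall v, (forall x, U x -> derivable f x v) /\ Ck k' U (fun x => 'D_v f x)
  else True.

Definition smooth_on {V W : normedModType R} (U : set V) (f : V -> W) :=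
  forall k, Ck k U f.

(* Smoothness on a compact interval means that there is a smooth extension to
   an open interval containing it. *)
Definition smooth_itv (a b : R) (f : R -> R) :=
  exists (e : R) (g : R -> R),
    [/\ 0 < e, smooth_on `]a - e, b + e[%classic g & {in `[a, b], g =1 f}].

Definition itv_diffeo (a b c d : R) (f : R -> R) :=
  smooth_itv a b f /\
  exists2 g : R -> R, smooth_itv c d g &
    [/\ {in `[a, b], forall t, f t \in `[c, d]},
        {in `[c, d], forall t, g t \in `[a, b]},
        {in `[a, b], cancel f g} & {in `[c, d], cancel g f}].

End smoothness.

Section spacetimes.
Context {R : realType}.

Record chart (n : nat) (M : topologicalType) := Chart {
  chart_dom : set M;
  coord : M -> 'rV[R]_n.+1;
  param : 'rV[R]_n.+1 -> M }.

Definition chart_img n M (c : chart n M) := coord c @` chart_dom c.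

Definition is_chart n M (c : chart n M) :=
  [/\ open (chart_dom c), open (chart_img c),
      {in chart_dom c, cancel (coord c) (param c)},
      {in chart_dom c, continuous (coord c)} &
      {in chart_img c, continuous (param c)}].

Definition transition n M (c c' : chart n M) := coord c' \o param c.

Definition chart_jacobian n M (c c' : chart n M) (p : M) : 'M[R]_n.+1 :=
  jacobian (transition c c') (coord c p).

Definition lorentz_signature n (G : 'M[R]_n.+1) :=
  exists2 P : 'M[R]_n.+1, P \in unitmx &
    P *m G *m P^T = diag_mx (\row_j (if j == ord0 then -1 else 1)).

(* A tangent vector at p is given by its components (a row vector) in each
   chart around p; the components in c' are obtained from those in c by right
   multiplication by chart_jacobian c c' p. [metric c p] is the Gram matrix of
   the coordinate basis of c at p. The time orientation is given by a
   continuous timelike vector field, declared to be future-directed. *)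
Record spacetime (n : nat) (M : topologicalType) := Spacetime {
  atlas : set (chart n M);
  metric : chart n M -> M -> 'M[R]_n.+1;
  orientation : chart n M -> M -> 'rV[R]_n.+1;
  spacetime_hausdorff : hausdorff_space M;
  spacetime_second_countable : @second_countable M;
  spacetime_connected : connected [set: M];
  atlas_charts : forall c, atlas c -> is_chart c;
  atlas_cover : forall p, exists2 c, atlas c & chart_dom c p;
  atlas_smooth : forall c c', atlas c -> atlas c' ->
    smooth_on (coord c @` (chart_dom c `&` chart_dom c')) (transition c c');
  metric_smooth : forall c, atlas c ->
    smooth_on (chart_img c) (metric c \o param c);
  metric_sym : forall c p, atlas c -> chart_dom c p ->
    (metric c p)^T = metric c p;
  metric_lorentz : forall c p, atlas c -> chart_dom c p ->
    lorentz_signature (metric c p);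
  metric_tensor : forall c c' p, atlas c -> atlas c' ->
    chart_dom c p -> chart_dom c' p ->
    metric c p =
    chart_jacobian c c' p *m metric c' p *m (chart_jacobian c c' p)^T;
  orientation_continuous : forall c, atlas c ->
    {in chart_dom c, continuous (orientation c)};
  orientation_timelike : forall c p, atlas c -> chart_dom c p ->
    (orientation c p *m metric c p *m (orientation c p)^T) ord0 ord0 < 0;
  orientation_vector : forall c c' p, atlas c -> atlas c' ->
    chart_dom c p -> chart_dom c' p ->
    orientation c' p = orientation c p *m chart_jacobian c c' p }.

Section causality.
Context {n : nat} {M : topologicalType} (S : spacetime n M).

Definition inner (c : chart n M) (p : M) (u v : 'rV[R]_n.+1) : R :=
  (u *m metric S c p *m v^T) ord0 ord0.

Definition causal_vector c p v := v != 0 /\ inner c p v v <= 0.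

Definition future_vector c p v :=
  causal_vector c p v /\ inner c p (orientation S c p) v < 0.

Definition past_vector c p v :=
  causal_vector c p v /\ 0 < inner c p (orientation S c p) v.

Definition smooth_curve (I : set R) (gamma : R -> M) :=
  {in I, continuous gamma} /\
  forall c, atlas S c ->
    smooth_on (I `&` gamma @^-1` chart_dom c) (coord c \o gamma).

(* A curve [a, b] -> M is represented by a function R -> M of which only the
   values on [a, b] matter. The velocity at the endpoints does not depend on
   the smooth extension g. *)
Definition directed_curve
    (K : chart n M -> M -> 'rV[R]_n.+1 -> Prop) (a b : R) (gamma : R -> M) :=
  a < b /\
  exists (e : R) (g : R -> M),
    [/\ 0 < e, smooth_curve `]a - e, b + e[%classic g,
        {in `[a, b], g =1 gamma} &
        forall t c, t \in `[a, b] -> atlas S c -> chart_dom c (gamma t) ->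
          K c (gamma t) ('D_1 (coord c \o g) t)].

Definition future_causal := directed_curve future_vector.
Definition past_causal := directed_curve past_vector.

Definition causal_le (p q : M) :=
  p = q \/ exists (a b : R) (gamma : R -> M),
    [/\ future_causal a b gamma, gamma a = p & gamma b = q].

Definition time_function (tau : M -> R) :=
  continuous tau /\
  forall a b gamma, future_causal a b gamma ->
    {in `[a, b] &, {homo tau \o gamma : s t / s < t}}.

(* s lists the points s_1 < ... < s_k = b of the partition; it is empty exactly
   for the degenerate interval a = b. *)
Definition causal_partition (beta : R -> M) (a b : R) (s : seq R) :=
  itv_partition a b s /\
  forall i, (i < size s)%N ->
    let x := nth b (a :: s) i in let y := nth b (a :: s) i.+1 in
    future_causal x y beta \/ past_causal x y beta.

Definition piecewise_causal (a b : R) (beta : R -> M) :=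
  {within `[a, b], continuous beta} /\ exists s, causal_partition beta a b s.

(* The sum of |tau (beta s_i) - tau (beta s_(i-1))| over a causal partition; it
   does not depend on the chosen one, see [null_lengthE] below. *)
Definition null_length (tau : M -> R) (a b : R) (beta : R -> M) : R :=
  variation a b (tau \o beta) (xget [::] [set s | causal_partition beta a b s]).

Definition null_distance (tau : M -> R) (p q : M) : \bar R :=
  ereal_inf [set l | exists (a b : R) (beta : R -> M),
    [/\ piecewise_causal a b beta, beta a = p, beta b = q &
        l = (null_length tau a b beta)%:E]].

End causality.

Definition distance_on (T : Type) (U : set T) (d : T -> T -> R) :=
  [/\ forall p q, U p -> U q -> 0 <= d p q,
      forall p q, U p -> U q -> (d p q = 0 <-> p = q),
      forall p q, U p -> U q -> d p q = d q p &
      forall p q r, U p -> U q -> U r -> d p r <= d p q + d q r].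

Definition anti_lipschitz_on n M (S : spacetime n M) (U : set M) (f : M -> R) :=
  exists2 d : M -> M -> R, distance_on U d &
    forall p q, U p -> U q -> causal_le S p q -> d p q <= f q - f p.

Definition locally_anti_lipschitz n M (S : spacetime n M) (f : M -> R) :=
  forall p : M, exists2 U, nbhs p U & anti_lipschitz_on S U f.

End spacetimes.

Section length_structures.
Context {R : realType} {X : topologicalType}.

Definition concat_path (c : R) (beta gamma : R -> X) (t : R) : X :=
  if t <= c then beta t else gamma t.

(* [A a b beta] means that the restriction of beta to [a, b] belongs to the
   class; hence the requirement [path_ext] that A only sees this restriction. *)
Record admissible (A : R -> R -> (R -> X) -> Prop) : Prop := Admissible {
  path_itv : forall a b beta, A a b beta -> a <= b;
  path_continuous : forall a b beta, A a b beta ->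
    {within `[a, b], continuous beta};
  path_ext : forall a b beta gamma, {in `[a, b], beta =1 gamma} ->
    A a b beta -> A a b gamma;
  path_restrict : forall a b c d beta, A a b beta ->
    a <= c -> c <= d -> d <= b -> A c d beta;
  path_concat : forall a b c beta gamma, A a c beta -> A c b gamma ->
    beta c = gamma c -> A a b (concat_path c beta gamma);
  path_reparam : forall a b c d beta phi, A a b beta ->
    itv_diffeo c d a b phi -> A c d (beta \o phi) }.

Record length_structure (A : R -> R -> (R -> X) -> Prop)
    (L : R -> R -> (R -> X) -> \bar R) : Prop := LengthStructure {
  length_admissible : admissible A;
  length_ext : forall a b beta gamma, A a b beta ->
    {in `[a, b], beta =1 gamma} -> L a b beta = L a b gamma;
  length_ge0 : forall a b beta, A a b beta -> (0 <= L a b beta)%E;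
  length_additive : forall a b c beta, A a b beta -> c \in `[a, b] ->
    L a b beta = (L a c beta + L c b beta)%E;
  length_continuous : forall a b beta, A a b beta ->
    {within `[a, b], continuous (fun t => L a t beta)};
  length_reparam : forall a b c d beta phi, itv_diffeo c d a b phi ->
    A a b beta -> A c d (beta \o phi) -> L c d (beta \o phi) = L a b beta;
  length_topology : forall p U, nbhs p U ->
    (0 < ereal_inf [set l | exists (a b : R) (beta : R -> X),
      [/\ A a b beta, beta a = p, ~ U (beta b) & l = L a b beta]])%E }.

Definition intrinsic_metric (A : R -> R -> (R -> X) -> Prop)
    (L : R -> R -> (R -> X) -> \bar R) (p q : X) : \bar R :=
  ereal_inf [set l | exists (a b : R) (beta : R -> X),
    [/\ A a b beta, beta a = p, beta b = q & l = L a b beta]].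

Definition length_space (d : X -> X -> R) :=
  distance_on [set: X] d /\
  exists (A : R -> R -> (R -> X) -> Prop) (L : R -> R -> (R -> X) -> \bar R),
    length_structure A L /\ forall p q, intrinsic_metric A L p q = (d p q)%:E.

End length_structures.

Section null_length_welldef.
Context {R : realType}.

Lemma diff_quotient_reflect {V : normedModType R} (s : R) (f : R -> V)
    (x v : R) :
  (fun h : R => h^-1 *: (((f \o (fun t => s - t)) \o shift x) (h *: v)
                         - (f \o (fun t => s - t)) x)) =
  (fun h : R => h^-1 *: ((f \o shift (s - x)) (h *: - v) - f (s - x))).
Proof.
apply/funext => h /=; congr (_ *: (f _ - _)).
by rewrite /GRing.scale/=; ring.
Qed.

Lemma derivable_reflect {V : normedModType R} (s : R) (f : R -> V) (x v : R) :
  derivable (f \o (fun t => s - t)) x v = derivable f (s - x) (- v).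
Proof. by rewrite /derivable diff_quotient_reflect. Qed.

Lemma derive_reflect {V : normedModType R} (s : R) (f : R -> V) (x v : R) :
  'D_v (f \o (fun t => s - t)) x = 'D_(- v) f (s - x).
Proof. by rewrite /derive diff_quotient_reflect. Qed.

Lemma continuous_reflect {T : topologicalType} (s : R) (U : set R)
    (f : R -> T) : {in U, continuous f} ->
  {in (fun t => s - t) @^-1` U, continuous (f \o (fun t => s - t))}.
Proof.
move=> cf x; rewrite inE => Ux; apply: continuous_comp.
  by apply: cvgB; [exact: cvg_cst|exact: cvg_id].
by apply: cf; rewrite inE.
Qed.

Lemma Ck_reflect {V : normedModType R} k (s : R) (U : set R) (f : R -> V) :
  Ck k U f -> Ck k ((fun t => s - t) @^-1` U) (f \o (fun t => s - t)).
Proof.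
elim: k U f => [|k IH] U f [cf df]; split => //; try exact: continuous_reflect.
move=> v; have [dfv Cfv] := df (- v); split.
  by move=> x Ux; rewrite derivable_reflect; exact: dfv.
suff -> : (fun x => 'D_v (f \o (fun t => s - t)) x) =
          (fun x => 'D_(- v) f x) \o (fun t => s - t) by exact: IH.
by apply/funext => x; rewrite derive_reflect.
Qed.

Context {n : nat} {M : topologicalType} (S : @spacetime R n M).

Lemma past_causal_reflect a b beta : past_causal S a b beta ->
  future_causal S a b (beta \o (fun t => a + b - t)).
Proof.
move=> [ab [e [g [e0 [cg sg] gb Kg]]]]; split => //.
have rI : (fun t => a + b - t) @^-1` `]a - e, b + e[ = `]a - e, b + e[%classic.
  by apply/seteqP; split => t /=; rewrite !in_itv/= => /andP[? ?];
    apply/andP; split; lra.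
have rab t : t \in `[a, b] -> a + b - t \in `[a, b].
  by rewrite !in_itv/= => /andP[? ?]; apply/andP; split; lra.
exists e, (g \o (fun t => a + b - t)); split => //.
- split; first by rewrite -rI; exact: continuous_reflect.
  move=> c Ac k; rewrite -{1}rI; exact: (Ck_reflect _ (sg c Ac k)).
- by move=> t tab; rewrite /= gb// rab.
- move=> t c tab Ac ct /=.
  have [[v0 vv] Xv] := Kg _ c (rab _ tab) Ac ct.
  rewrite (derive_reflect (a + b) (coord c \o g)).
  suff -> : 'D_(-1) (coord c \o g) (a + b - t) =
            - 'D_1 (coord c \o g) (a + b - t).
    rewrite /future_vector /causal_vector /inner.
    move: v0 vv Xv; rewrite /inner.
    set w := 'D_1 (coord c \o g) _ => v0 vv Xv.
    rewrite oppr_eq0 !mulNmx [(- w)^T]raddfN !mulmxN/= opprK.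
    by rewrite [(- (_ *m _)) _ _]mxE oppr_lt0.
  have dg : differentiable (coord c \o g) (a + b - t).
    apply/derivable1_diffP; have [_ /(_ 1)[+ _]] := sg c Ac 1%N; apply.
    split; last by rewrite /= gb ?rab.
    move: (rab _ tab); rewrite /= !in_itv/= => /andP[? ?].
    by apply/andP; split; lra.
  by rewrite !deriveE// linearN.
Qed.

Lemma total_variation_causal tau beta a b : time_function S tau ->
  future_causal S a b beta \/ past_causal S a b beta ->
  total_variation a b (tau \o beta) = `|tau (beta b) - tau (beta a)|%:E.
Proof.
move=> [_ tauS] [fut|past].
  have [ab _] := fut.
  have nd : {in `[a, b] &, nondecreasing_fun (tau \o beta)}.
    by move=> x y xab yab; rewrite le_eqVlt => /predU1P[->//|xy];
      apply/ltW; exact: (tauS _ _ _ fut).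
  rewrite nondecreasing_total_variation ?ltW//= ger0_norm// subr_ge0.
  by apply: nd; rewrite ?in_itv/= ?lexx ?ltW.
have [ab _] := past.
have nd : {in `[a, b] &, nondecreasing_fun (\- (tau \o beta))}.
  move=> x y xab yab; rewrite le_eqVlt => /predU1P[->//|xy].
  have /= := tauS _ _ _ (past_causal_reflect past) (a + b - y) (a + b - x).
  rewrite !subKr !lerN2 => H; apply/ltW/H; last by lra.
  - by move: yab; rewrite !in_itv/= => /andP[? ?]; apply/andP; split; lra.
  - by move: xab; rewrite !in_itv/= => /andP[? ?]; apply/andP; split; lra.
rewrite -total_variationN nondecreasing_total_variation ?ltW//=.
have /= : (\- (tau \o beta)) a <= (\- (tau \o beta)) b.
  by apply: nd; rewrite ?in_itv/= ?lexx ?ltW.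
by rewrite lerN2 => H; rewrite ler0_norm ?subr_le0// opprB addrC opprK.
Qed.

Lemma variation_causal_partition tau beta a b s : time_function S tau ->
  causal_partition S beta a b s ->
  total_variation a b (tau \o beta) = (variation a b (tau \o beta) s)%:E.
Proof.
move=> tauS; elim: s a => [|x s IH] a [abs cs].
  by rewrite (itv_partition_nil abs) total_variationxx /variation/= big_nil.
have xbs := itv_partition_cons abs.
have xb := itv_partition_le xbs.
have ax : a < x by move: abs => [/= /andP[]].
have csx : causal_partition S beta x b s by split=> // i si; exact: (cs i.+1).
rewrite (total_variationD _ (ltW ax) xb) (IH _ csx).
rewrite (total_variation_causal tauS (cs 0%N isT))/=.
rewrite -EFinD -cat1s (variation_cat _ (ltW ax) xb (itv_partition1 ax) xbs).
by congr (_ + _)%:E; rewrite /variation/= big_nat1.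
Qed.

Lemma null_lengthE tau beta a b s : time_function S tau ->
  causal_partition S beta a b s ->
  null_length S tau a b beta = variation a b (tau \o beta) s.
Proof.
move=> tauS cs; rewrite /null_length; case: xgetP => [t _ /= ct|/(_ s)//].
apply: EFin_inj.
by rewrite -!(variation_causal_partition tauS).
Qed.

End null_length_welldef.

(* Main.v *)
Require Import Defs.
From HB Require Import structures.
From mathcomp Require Import all_boot all_order all_algebra.
From mathcomp Require Import all_classical all_reals all_analysis.
From mathcomp Require Import ring lra.
(* [vector] also defines [coord]: give precedence to the chart coordinates. *)
Import Defs.

(** A causal piece of a path from x to y has null length |tau y - tau x|, which
    is the total variation of tau along it. Hence the null length of a
    piecewise causal path is a total variation, so that it is additive and
    continuous. A diffeomorphism of intervals has a nowhere vanishing derivative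
    of constant sign, so it maps causal pieces to causal pieces and the total
    variation is unchanged.

    In a chart around p, a segment whose direction is close to the time
    orientation is timelike. Hence there are points x arbitrarily close to p
    from which future-directed segments reach every point near p. By
    connectedness, any two points are joined by a piecewise causal path.
    Moreover, if d is the distance of the anti-Lipschitz condition, then
    d(p, q) <= d(x, p) + d(x, q) <= (tau p - tau x) + (tau q - tau x) for q near
    p: although d is not assumed to induce the topology of M, it is continuous.
    So d(p, .) has a positive minimum on a small coordinate sphere around p, and
    a path from p which leaves the ball has at least this null length. This
    gives (iv), and with it that the null distance is definite. *)

Set Implicit Arguments.
Unset Strict Implicit.
Unset Printing Implicit Defensive.

Import Order.TTheory GRing.Theory Num.Theory.
Import numFieldNormedType.Exports.

Local Open Scope classical_set_scope.
Local Open Scope ring_scope.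

(** * Functions of class C^k: restriction to lines, local congruence, sums *)

Section Ck.
Context {R : realType}.
Implicit Types V W : normedModType R.

Lemma diff_quotient_line V W (f : V -> W) (z v : V) (t w : R) :
  (fun h : R => h^-1 *: (((f \o (fun s => z + s *: v)) \o shift t) (h *: w)
                         - (f \o (fun s => z + s *: v)) t)) =
  (fun h : R => h^-1 *: ((f \o shift (z + t *: v)) (h *: (w *: v))
                         - f (z + t *: v))).
Proof.
apply/funext => h /=; congr (_ *: (f _ - _)).
by rewrite scalerDl -scalerA addrCA.
Qed.

Lemma derivable_line V W (f : V -> W) z v (t w : R) :
  derivable (f \o (fun s => z + s *: v)) t w =
  derivable f (z + t *: v) (w *: v).
Proof. by rewrite /derivable diff_quotient_line. Qed.

Lemma derive_line V W (f : V -> W) z v (t w : R) :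
  'D_w (f \o (fun s => z + s *: v)) t = 'D_(w *: v) f (z + t *: v).
Proof. by rewrite /derive diff_quotient_line. Qed.

Lemma continuous_line V (z v : V) : continuous (fun s : R => z + s *: v).
Proof.
by move=> s; apply: cvgD; [exact: cvg_cst|apply: cvgZr_tmp; exact: cvg_id].
Qed.

Lemma Ck_line V W k (U : set V) (f : V -> W) z v : Ck k U f ->
  Ck k ((fun s : R => z + s *: v) @^-1` U) (f \o (fun s => z + s *: v)).
Proof.
elim: k f => [|k IH] f [cf df]; split => //;
  try (move=> s; rewrite inE => Us; apply: continuous_comp;
       [exact: continuous_line|by apply: cf; rewrite inE]).
move=> w; have [dfw Cfw] := df (w *: v); split.
  by move=> s Us; rewrite derivable_line; exact: dfw.
suff -> : (fun s => 'D_w (f \o (fun s => z + s *: v)) s) =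
          (fun y => 'D_(w *: v) f y) \o (fun s => z + s *: v) by exact: IH.
by apply/funext => s; rewrite derive_line.
Qed.

Lemma Ck_subset V W k (U U' : set V) (f : V -> W) :
  U' `<=` U -> Ck k U f -> Ck k U' f.
Proof.
elim: k f => [|k IH] f UU [cf df]; split => //;
  try by move=> x; rewrite inE => U'x; apply: cf; rewrite inE; exact: UU.
move=> v; have [dfv Cfv] := df v; split; last exact: IH.
by move=> x /UU; exact: dfv.
Qed.

Lemma CkW V W k (U : set V) (f : V -> W) : Ck k.+1 U f -> Ck k U f.
Proof.
elim: k f => [|k IH] f [cf df]; split => // v.
by have [dfv Cfv] := df v; split => //; exact: IH.
Qed.

(** On an open set, equality on [U] is equality near each point, so limits and derivatives agree.
    This lets a derivative be replaced by a formula valid only on [U]. *)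
Lemma Ck_eq V W k (U : set V) (f g : V -> W) :
  open U -> {in U, f =1 g} -> Ck k U f -> Ck k U g.
Proof.
move=> oU; elim: k f g => [|k IH] f g fg [cf df].
all: have nfg x : U x -> \forall y \near x, f y = g y by
  move=> Ux; near=> y; apply: fg; rewrite inE; near: y; exact: open_nbhs_nbhs.
all: have cg : {in U, continuous g} by
  move=> x /[dup] Ux; rewrite inE => Ux'; rewrite /continuous_at -fg//;
  apply: cvg_trans (cf x Ux); apply: near_eq_cvg; exact: nfg.
- by split.
- split => // v; have [dfv Cfv] := df v; split.
    by move=> x Ux; apply: near_eq_derivable (dfv x Ux); exact: nfg.
  apply: IH Cfv => x; rewrite inE => Ux.
  by apply: near_eq_derive; exact: nfg.
Unshelve. all: by end_near. Qed.

Lemma CkD V W k (U : set V) (f g : V -> W) :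
  open U -> Ck k U f -> Ck k U g -> Ck k U (f \+ g).
Proof.
move=> oU; elim: k f g => [|k IH] f g [cf df] [cg dg]; split => //;
  try by move=> x Ux; apply: cvgD; [exact: cf|exact: cg].
move=> v; have [[dfv Cfv] [dgv Cgv]] := (df v, dg v); split.
  by move=> x Ux; apply: derivableD; [exact: dfv|exact: dgv].
apply: Ck_eq (IH _ _ Cfv Cgv) => // x; rewrite inE => Ux.
by rewrite [RHS]deriveD//; [exact: dfv|exact: dgv].
Qed.

End Ck.

(** * Product and chain rules, and differentiability of C^1 maps *)

Section C1.
Context {R : realType}.
Implicit Types V W : normedModType R.

Lemma cvg_sum (W : normedModType R) (I : finType) (T : Type) (F : set_system T)
    (f : I -> T -> W) (l : I -> W) : Filter F ->
  (forall i, f i x @[x --> F] --> l i) ->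
  \sum_i f i x @[x --> F] --> \sum_i l i.
Proof. by move=> FF fl; apply: cvg_big => //; exact: add_continuous. Qed.

Lemma is_deriveZ_fun V W (a : V -> R) (f : V -> W) x v :
  derivable a x v -> derivable f x v -> {for x, continuous f} ->
  is_derive x v (fun y => a y *: f y) ('D_v a x *: f x + a x *: 'D_v f x).
Proof.
move=> da df cf.
suff H : (fun h : R => h^-1 *: (((fun y => a y *: f y) \o shift x) (h *: v)
          - a x *: f x)) @ 0^' --> 'D_v a x *: f x + a x *: 'D_v f x.
  by apply: DeriveDef; [apply/cvg_ex; eexists; exact: H|exact: cvg_lim H].
(* The increment of the product is split as the increment of [a] times the shifted [f], plus [a x]
   times the increment of [f]. *)
have -> : (fun h : R => h^-1 *: (((fun y => a y *: f y) \o shift x) (h *: v)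
          - a x *: f x)) =
  (fun h : R => (h^-1 *: ((a \o shift x) (h *: v) - a x)) *:
                 (f \o shift x) (h *: v)
              + a x *: (h^-1 *: ((f \o shift x) (h *: v) - f x))).
  apply/funext => h /=.
  rewrite -[h^-1 *: (_ - a x)]/(h^-1 * _) -scalerA [a x *: (_ *: _)]scalerA.
  rewrite [a x * _]mulrC -scalerA -scalerDr; congr (_ *: _).
  by rewrite scalerBl scalerBr addrA subrK.
apply: cvgD; last by apply: cvgZl_tmp; exact: df.
apply: cvgZ; first exact: da.
have cs : (h *: v + x) @[h --> (0:R)^'] --> x.
  rewrite -[in X in _ --> X](add0r x).
  apply: cvgD; last exact: cvg_cst.
  rewrite -(scale0r v); apply: cvgZr_tmp; exact: nbhs_dnbhs.
exact: (cvg_comp _ _ cs cf).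
Qed.

(** Induction on [k]: by the product rule the derivative is a sum of two products, each with one
    factor differentiated and the other lowered in order by [CkW]. *)
Lemma CkZ_fun V W k (U : set V) (a : V -> R) (f : V -> W) :
  open U -> Ck k U a -> Ck k U f -> Ck k U (fun y => a y *: f y).
Proof.
move=> oU; elim: k a f => [|k IH] a f Ca Cf.
all: split => //; try by move=> x Ux; apply: cvgZ; [exact: Ca.1|exact: Cf.1].
move=> v; have [[dav Cav] [dfv Cfv]] := (Ca.2 v, Cf.2 v).
have D x : U x ->
    is_derive x v (fun y => a y *: f y) ('D_v a x *: f x + a x *: 'D_v f x).
  move=> Ux; apply: is_deriveZ_fun; [exact: dav|exact: dfv|].
  by apply: Cf.1; rewrite inE.
split; first by move=> x /D [].
apply: Ck_eq (CkD oU (IH _ _ Cav (CkW Cf)) (IH _ _ (CkW Ca) Cfv)) => // x.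
by rewrite inE => /D [_ ->].
Qed.

Lemma Ck_derivable W k (U : set R) (f : R -> W) x :
  Ck k.+1 U f -> U x -> derivable f x 1.
Proof. by move=> [_ /(_ 1)[+ _]]; exact. Qed.

Lemma Ck_differentiable W k (U : set R) (f : R -> W) x :
  Ck k.+1 U f -> U x -> differentiable f x.
Proof. by move=> Cf Ux; apply/derivable1_diffP; exact: Ck_derivable Cf Ux. Qed.

Lemma derive_compR W (phi : R -> R) (f : R -> W) (x v : R) :
  differentiable phi x -> differentiable f (phi x) ->
  'D_v (f \o phi) x = 'D_v phi x *: 'D_1 f (phi x).
Proof.
move=> dp df.
rewrite !deriveE//; last exact: differentiable_comp.
rewrite diff_comp//= -[X in 'd f (phi x) X]mulr1.
by rewrite -[_ * 1]/(_ *: (1 : R)) linearZ.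
Qed.

(** Induction on [k]: the derivative is the derivative of [phi] times ['D_1 f \o phi], to which the
    product rule and the induction hypothesis apply. *)
Lemma Ck_comp W k (I J : set R) (phi : R -> R) (f : R -> W) : open J ->
  (forall t, J t -> I (phi t)) ->
  Ck k J phi -> Ck k I f -> Ck k J (f \o phi).
Proof.
move=> oJ JI; elim: k f => [|k IH] f Cp Cf.
all: have cc : {in J, continuous (f \o phi)} by
  move=> t; rewrite inE => Jt; apply: continuous_comp;
  [by apply: Cp.1; rewrite inE|by apply: Cf.1; rewrite inE; exact: JI].
  by split.
split => // v; split.
  move=> t Jt; apply/diff_derivable/differentiable_comp.
    exact: Ck_differentiable Cp Jt.
  exact: Ck_differentiable Cf (JI _ Jt).
have /(_ v) [_ Cpv] := Cp.2; have /(_ 1) [_ Cf1] := Cf.2.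
apply: Ck_eq (CkZ_fun oJ Cpv (IH _ (CkW Cp) Cf1)) => // t; rewrite inE => Jt.
rewrite /= derive_compR//; first exact: Ck_differentiable Cp Jt.
exact: Ck_differentiable Cf (JI _ Jt).
Qed.

(** The one-variable mean value theorem along the line through [y], between 0 and [s] in whichever
    order they come. *)
Lemma MVT_line V (f : V -> R) (y v : V) (s : R) :
  (forall t : R, `|t| <= `|s| -> derivable f (y + t *: v) v) ->
  exists2 c : R, `|c| <= `|s| & f (y + s *: v) - f y = s * 'D_v f (y + c *: v).
Proof.
move=> df.
pose g (t : R) : R := f (y + t *: v).
pose dg (t : R) : R := 'D_v f (y + t *: v).
have Dg (t : R) : `|t| <= `|s| -> is_derive t 1 g (dg t).
  move=> ts; have gE : g = f \o (fun t => y + t *: v) by [].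
  by split; rewrite gE ?derivable_line ?derive_line scale1r//; exact: df.
have [s0|s0] := leP 0 s.
  have [|c|c] := @MVT_segment R g dg 0 s s0.
  - move=> x; rewrite in_itv/= => /andP[x0 xs]; apply: Dg.
    by rewrite !ger0_norm// ltW.
  - apply: derivable_within_continuous => x; rewrite in_itv/= => /andP[x0 xs].
    by have [] := Dg x; rewrite ?ger0_norm.
  rewrite in_itv/= => /andP[c0 cs]; rewrite subr0 /g scale0r addr0 mulrC => E.
  by exists c => //; rewrite !ger0_norm.
have [|c|c] := @MVT_segment R g dg s 0 (ltW s0).
- move=> x; rewrite in_itv/= => /andP[x0 xs]; apply: Dg.
  by rewrite !ler0_norm ?lerN2// ltW.
- apply: derivable_within_continuous => x; rewrite in_itv/= => /andP[x0 xs].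
  by have [] := Dg x; rewrite ?ler0_norm ?lerN2// ltW.
rewrite in_itv/= => /andP[c0 cs]; rewrite sub0r /g scale0r addr0 => E.
exists c; first by rewrite !ler0_norm ?lerN2// ltW.
by rewrite -opprB E mulrN opprK mulrC.
Qed.

Lemma differentiable_error_bound V W (f : V -> W) (L : {linear V -> W}) x :
  continuous L ->
  (forall e : R, 0 < e ->
    \forall h \near 0, `|f (h + x) - (f x + L h)| <= e * `|h|) ->
  differentiable f x.
Proof.
move=> cL H.
have fL : f \o shift x = cst (f x) + L +o_ 0 id by apply/eqaddoP.
by apply/diff_locallyP; rewrite (diff_unique cL fL).
Qed.

(** [Ck] speaks only of directional derivatives; a total differential follows from continuity of the
    partial ones. The candidate [L] is built from the partials at [x], and the mean value theorem
    bounds the error one coordinate at a time. *)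
Lemma C1_differentiable_scalar n (U : set 'rV[R]_n.+1)
    (f : 'rV[R]_n.+1 -> R) x :
  open U -> U x -> Ck 1 U f -> differentiable f x.
Proof.
move=> oU Ux [cf df].
pose e i : 'rV[R]_n.+1 := delta_mx 0 i.
pose L (v : 'rV[R]_n.+1) : R := \sum_i v 0 i * 'D_(e i) f x.
have linL : linear L.
  move=> a u v; rewrite /L scaler_sumr -big_split/=; apply: eq_bigr => i _.
  by rewrite !mxE mulrDl -mulrA.
pose LM := GRing.isLinear.Build _ _ _ _ _ linL.
pose LL : {linear 'rV[R]_n.+1 -> R} := HB.pack L LM.
have cL : continuous LL.
  move=> v; change ((fun u => L u) @ nbhs v --> L v).
  apply: (@cvg_sum _ _ _ (nbhs v)
    (fun i (u : 'rV[R]_n.+1) => u 0 i * 'D_(e i) f x)) => i.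
  apply: (@cvgM _ _ (nbhs v) _ (fun u : 'rV[R]_n.+1 => u 0 i)).
    exact: coord_continuous.
  exact: cvg_cst.
apply: (differentiable_error_bound cL) => _/posnumP[eps].
(* The error is a sum of [n.+1] terms, one for each coordinate. *)
have n0 : 0 < eps%:num / n.+1%:R :> R by rewrite divr_gt0.
have : \forall y \near x, U y /\
    forall i, `|'D_(e i) f x - 'D_(e i) f y| <= eps%:num / n.+1%:R.
  near=> y; split; first by near: y; exact: open_nbhs_nbhs.
  near: y; apply: filter_forall => i.
  have [_ /= [/(_ x)]] := df (e i).
  by rewrite inE => /(_ Ux)/cvgrPdist_le/(_ _ n0).
move=> /nbhs_ballP[r /= r0 Hr].
near=> h.
have hr : `|h| < r by near: h; exact: cvgr0_norm_lt.
(* The segments from x + p k to x + p k.+1 join x to x + h and are parallel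
   to the coordinate axes. *)
pose p k : 'rV[R]_n.+1 := \row_j (if (j < k)%N then h 0 j else 0).
have hE : h = p n.+1 by apply/rowP => j; rewrite mxE ltn_ord.
have p0 : p 0%N = 0 by apply/rowP => j; rewrite !mxE.
have pS (k : 'I_n.+1) : p k.+1 = p k + h 0 k *: e k.
  apply/rowP => j; rewrite !mxE eqxx/= ltnS leq_eqVlt.
  have [/val_inj ->|jk] /= := eqVneq (j : nat) k.
    by rewrite ltnn eqxx mulr1 add0r.
  by rewrite -val_eqE/= (negbTE jk) mulr0 addr0.
have hle j : `|h 0 j| <= `|h|.
  rewrite [leRHS]/Num.Def.normr/= mx_normrE.
  exact: (le_bigmax _ (fun i : 'I_1 * 'I_n.+1 => `|h i.1 i.2|) (0, j)).
have -> : f (h + x) - (f x + L h) =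
    \sum_(k < n.+1) (f (x + p k.+1) - f (x + p k) - h 0 k * 'D_(e k) f x).
  rewrite big_split/= sumrN opprD addrA -/(L h); congr (_ - _).
  rewrite -(big_mkord xpredT (fun k => f (x + p k.+1) - f (x + p k))).
  rewrite (telescope_sumr (fun j => f (x + p j)))// p0 addr0 -hE.
  by rewrite [x + h]addrC.
apply: (@le_trans _ R (\sum_(k < n.+1)
  `|f (x + p k.+1) - f (x + p k) - h 0 k * 'D_(e k) f x|)).
  exact: ler_norm_sum.
have bnd (k : 'I_n.+1) :
   `|f (x + p k.+1) - f (x + p k) - h 0 k * 'D_(e k) f x| <=
   eps%:num / n.+1%:R * `|h|.
  (* The offset from [x] has the coordinates of [h] before [k], then [t], then zeros; in the maximum
     norm it is at most the norm of [h]. *)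
  have inb t : `|t| <= `|h 0 k| -> ball x r (x + p k + t *: e k).
    move=> th; rewrite -ball_normE/= -addrA opprD addNKr normrN.
    apply: le_lt_trans hr; rewrite [leLHS]/Num.Def.normr/= mx_normrE.
    apply/bigmax_leP; split => //= -[i j] _ /=; rewrite (ord1 i) !mxE eqxx/=.
    have [->|jk] := eqVneq j k; first by rewrite ltnn add0r mulr1 (le_trans th).
    by rewrite mulr0 addr0; case: ifP => // _; rewrite normr0.
  have [|c ch] := @MVT_line _ f (x + p k) (e k) (h 0 k).
    by move=> t /inb/Hr[Ut _]; have [+ _] := df (e k); exact.
  rewrite -addrA -pS => ->; rewrite -mulrBr normrM mulrC distrC.
  apply: ler_pM => //; have [_] := Hr _ (inb _ ch); exact.
apply: (@le_trans _ R (\sum_(k < n.+1) eps%:num / n.+1%:R * `|h|)).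
  by apply: ler_sum => k _; exact: bnd.
by rewrite sumr_const card_ord -[_ *+ _]mulr_natr mulrAC divfK.
Unshelve. all: by end_near. Qed.

Lemma C1_differentiable n m (U : set 'rV[R]_n.+1)
    (f : 'rV[R]_n.+1 -> 'rV[R]_m.+1) x :
  open U -> U x -> Ck 1 U f -> differentiable f x.
Proof.
move=> oU Ux [cf df].
have -> : f = (fun z => \sum_(j < m.+1) f z 0 j *: delta_mx 0 j).
  by apply/funext => z; exact: row_sum_delta.
have -> : (fun z => \sum_(j < m.+1) f z 0 j *: delta_mx 0 j) =
   \sum_(j < m.+1) (fun z => f z 0 j *: (delta_mx 0 j : 'rV[R]_m.+1)).
  by apply/funext => z; rewrite fct_sumE.
apply: differentiable_sum => j.
apply: differentiableZl.
apply: (C1_differentiable_scalar oU Ux); split.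
  move=> y Uy; apply: (@continuous_comp _ _ _ f (fun M : 'rV_m.+1 => M 0 j)).
    exact: cf.
  exact: coord_continuous.
move=> v; have [dfv [cfv _]] := df v.
have dj y : U y -> 'D_v f y 0 j = 'D_v (fun z => f z 0 j) y.
  by move=> Uy; rewrite derive_mx ?mxE//; exact: dfv.
split; first by move=> y Uy; move: (dfv y Uy) => /derivable_mxP; exact.
split => //; apply: (@Ck_eq _ _ _ 0%N _ (fun y => 'D_v f y 0 j) _ oU _ _).1.
- by move=> y; rewrite inE; exact: dj.
- split => // y Uy.
  apply: (@continuous_comp _ _ _ ('D_v f) (fun M : 'rV_m.+1 => M 0 j)).
    exact: cfv.
  exact: coord_continuous.
Qed.

End C1.

(** * Calculus on intervals: diffeomorphisms, first exit times, affine maps *)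

Section intervals.
Context {R : realType}.
Implicit Types a b c d e t : R.

(** Nothing is known about [h] outside the interval, so the derivative is computed as a one-sided
    limit: from the right if [t < d], from the left at [d]. *)
Lemma derive_id_itv (h : R -> R) c d t : c < d -> derivable h t 1 ->
  {in `[c, d], h =1 id} -> t \in `[c, d] -> 'D_1 h t = 1.
Proof.
move=> cd dh hid tcd.
move: (tcd); rewrite in_itv/= => /andP[ct td].
have quot1 (s : R) : s != 0 -> s + t \in `[c, d] ->
    s^-1 *: ((h \o shift t) (s *: 1) - h t) = 1.
  move=> s0 std; rewrite /= [s *: 1]mulr1 !hid// addrK.
  by rewrite -[_ *: _]/(_ * _) mulVf.
have [tltd|dlet] := ltP t d.
  rewrite /derive cvg_at_rightE//; apply: cvg_lim => //.
  apply: (cvg_trans _ (@cvg_cst R 1 R (0:R)^'+ _)).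
  apply: near_eq_cvg; near=> s.
  have s0 : 0 < s by near: s; exact: nbhs_right_gt.
  rewrite quot1 ?gt_eqF// in_itv/=; apply/andP; split; first lra.
  by rewrite -lerBrDr; near: s; apply: nbhs_right_le; lra.
have cltt : c < t by lra.
rewrite /derive cvg_at_leftE//; apply: cvg_lim => //.
apply: (cvg_trans _ (@cvg_cst R 1 R (0:R)^'- _)).
apply: near_eq_cvg; near=> s.
have s0 : s < 0 by near: s; exact: nbhs_left_lt.
rewrite quot1 ?lt_eqF// in_itv/=; apply/andP; split; last lra.
by rewrite -lerBlDr; near: s; apply: nbhs_left_ge; lra.
Unshelve. all: by end_near. Qed.

(** By the chain rule, the derivative of [psi \o phi], which is 1 on the interval, would vanish
    wherever that of [phi] does. *)
Lemma smooth_itv_derive_neq0 a b c d (phi psi : R -> R) e e' : c < d ->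
  0 < e -> 0 < e' ->
  smooth_on `]c - e, d + e[%classic phi ->
  smooth_on `]a - e', b + e'[%classic psi ->
  {in `[c, d], forall t, phi t \in `[a, b]} ->
  {in `[c, d], cancel phi psi} ->
  forall t, t \in `[c, d] -> 'D_1 phi t != 0.
Proof.
move=> cd e0 e'0 sphi spsi phiab phiK t tcd.
have tI : t \in `]c - e, d + e[.
  by move: tcd; rewrite !in_itv/= => /andP[? ?]; apply/andP; split; lra.
have ptI : phi t \in `]a - e', b + e'[.
  move: (phiab _ tcd); rewrite !in_itv/= => /andP[? ?].
  by apply/andP; split; lra.
have dphi := Ck_differentiable (sphi 1%N) tI.
have dpsi := Ck_differentiable (spsi 1%N) ptI.
have dcomp : derivable (psi \o phi) t 1.
  by apply/derivable1_diffP; exact: differentiable_comp.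
apply/eqP => D0; have := derive_id_itv cd dcomp phiK tcd.
by rewrite derive_compR// D0 scale0r => /eqP; rewrite eq_sym oner_eq0.
Qed.

Lemma open_setI_preimage (T : topologicalType) (A : set R) (f : R -> T)
    (B : set T) :
  open A -> {in A, continuous f} -> open B -> open (A `&` f @^-1` B).
Proof.
move=> oA cf oB; rewrite openE => t [At Bt]; apply: filterI.
  exact: open_nbhs_nbhs.
by apply: (cf t); [rewrite inE|exact: open_nbhs_nbhs].
Qed.

(** A continuous derivative of both signs would have a zero by the intermediate value theorem; each
    sign is compared with the one at [c]. *)
Lemma derive_sign (f : R -> R) (J : set R) c d : smooth_on J f ->
  `[c, d] `<=` J -> c < d ->
  (forall t, t \in `[c, d] -> 'D_1 f t != 0) ->
  (forall t, t \in `[c, d] -> 0 < 'D_1 f t) \/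
  (forall t, t \in `[c, d] -> 'D_1 f t < 0).
Proof.
move=> sf cdJ cd D0.
have cD t : t \in `[c, d] -> {within `[c, t], continuous 'D_1 f}.
  rewrite in_itv/= => /andP[ct td].
  apply: continuous_in_subspaceT => s; rewrite inE/= in_itv/= => /andP[cs st].
  have [_ /(_ 1) [_ [+ _]]] := sf 1%N; apply; rewrite inE; apply: cdJ.
  by rewrite /= in_itv/= cs (le_trans st).
have ccd : c \in `[c, d] by rewrite in_itv/= lexx ltW.
have root t : t \in `[c, d] ->
    Num.min ('D_1 f c) ('D_1 f t) <= 0 <= Num.max ('D_1 f c) ('D_1 f t) ->
    False.
  move=> tcd; move: (tcd); rewrite in_itv/= => /andP[ct td].
  move=> /(IVT ct (cD t tcd))[s]; rewrite in_itv/= => /andP[cs st] /eqP.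
  by apply/negP/D0; rewrite in_itv/= cs (le_trans st).
have := D0 c ccd; rewrite neq_lt => /orP[Dc|Dc]; [right|left] => t tcd.
  rewrite ltNge; apply/negP => Dt; apply: (root t tcd).
  by rewrite ge_min (ltW Dc)/= le_max Dt orbT.
rewrite ltNge; apply/negP => Dt; apply: (root t tcd).
by rewrite ge_min Dt orbT/= le_max (ltW Dc).
Qed.

Lemma continuous_within_comp (T : topologicalType) (A B : set R) (f : R -> R)
    (g : R -> T) : (forall t, A t -> B (f t)) ->
  {within A, continuous f} -> {within B, continuous g} ->
  {within A, continuous (g \o f)}.
Proof.
move=> AB /subspace_continuousP cf /subspace_continuousP cg.
apply/subspace_continuousP => t At.
move=> U gU; have BU := cg (f t) (AB t At) U gU.
have AU : nbhs t [set s | A s -> B (f s) -> U (g (f s))] := cf t At _ BU.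
by apply: filterS AU => s /= sU As; apply: sU => //; exact: AB.
Qed.

Lemma itv_diffeo_continuous a b c d (phi : R -> R) : itv_diffeo c d a b phi ->
  {within `[c, d], continuous phi}.
Proof.
move=> [[e [f [e0 sf fphi]]] _].
apply: (@subspace_eq_continuous _ _ _ f).
  by move=> t; rewrite inE/= => /fphi.
apply: continuous_in_subspaceT => t; rewrite inE/= in_itv/= => /andP[ct td].
have [+ _] := sf 0%N; apply; rewrite inE/= in_itv/=.
by apply/andP; split; lra.
Qed.

(** The exit time is the infimum of the times spent outside [O]. Openness of [O] puts [f] outside at
    that time, and the earlier values put it in the closure. *)
Lemma first_exit (T : topologicalType) (O : set T) (f : R -> T) a b : open O ->
  a <= b -> {within `[a, b], continuous f} -> O (f a) -> ~ O (f b) ->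
  exists t, [/\ t \in `[a, b], ~ O (f t), closure O (f t) &
    forall s, a <= s -> s < t -> O (f s)].
Proof.
move=> oO ab /subspace_continuousP cf Oa Ob.
pose A := [set t | a <= t <= b /\ ~ O (f t)].
have Ab : A b by split; rewrite // ab lexx.
have lbA : lbound A a by move=> t [/andP[]].
have hA : has_inf A by split; [exists b|exists a].
have ainf : a <= inf A by apply: lb_le_inf => //; exists b.
have infb : inf A <= b by apply: ge_inf => //; exists a.
have tab : `[a, b]%classic (inf A) by rewrite /= in_itv/= ainf.
have nearf (N : set T) : nbhs (f (inf A)) N ->
    exists2 r, 0 < r & forall s, a <= s <= b -> `|inf A - s| < r -> N (f s).
  move=> /(cf _ tab)/nbhs_ballP[r /= r0 rN]; exists r => // s sab sr.
  by apply: (rN s) => //=; rewrite in_itv.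
have nO : ~ O (f (inf A)).
  move=> OA; have [r r0 rO] := nearf O (open_nbhs_nbhs (conj oO OA)).
  have [s [sab nOs] sr] := inf_adherent r0 hA.
  have As : inf A <= s by apply: ge_inf; [exists a|split].
  by apply: nOs; apply: rO => //; rewrite ltr_norml; apply/andP; split; lra.
have below s : a <= s -> s < inf A -> O (f s).
  move=> as_ sA; apply: contrapT => nOs.
  suff : inf A <= s by rewrite leNgt sA.
  apply: ge_inf; [by exists a|split => //].
  by rewrite as_ (le_trans (ltW sA)).
have altA : a < inf A.
  by rewrite lt_neqAle ainf andbT; apply/eqP => aA; apply: nO; rewrite -aA.
exists (inf A); split => //.
move=> N /nearf[r r0 rN].
(* The maximum keeps [s] in the interval; it remains before [inf A] and within [r] of it. *)
pose s := Num.max a (inf A - r / 2).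
have as_ : a <= s by rewrite le_max lexx.
have sA : s < inf A by rewrite gt_max altA/=; lra.
have rs : inf A - r / 2 <= s by rewrite le_max lexx orbT.
exists (f s); split; first exact: below.
apply: rN; first by rewrite as_ (le_trans (ltW sA)).
by rewrite ltr_norml; apply/andP; split; lra.
Qed.

(** Written in matrix entries, the form is a finite sum of products. A general filter allows base
    point and vectors to vary together. *)
Lemma cvg_form T (F : set_system T) (FF : Filter F) m (u w : T -> 'rV[R]_m.+1)
    (G : T -> 'M[R]_m.+1) (u0 w0 : 'rV[R]_m.+1) (G0 : 'M[R]_m.+1) :
  u x @[x --> F] --> u0 -> w x @[x --> F] --> w0 -> G x @[x --> F] --> G0 ->
  (u x *m G x *m (w x)^T) ord0 ord0 @[x --> F] --> (u0 *m G0 *m w0^T) ord0 ord0.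
Proof.
move=> cu cw cG.
have E (a b : 'rV[R]_m.+1) (A : 'M[R]_m.+1) : (a *m A *m b^T) ord0 ord0 =
    \sum_i (\sum_j a 0 j * A j i) * b 0 i.
  by rewrite mxE; apply: eq_bigr => i _; rewrite !mxE.
rewrite E; under eq_fun do rewrite E.
have cc k l (f : T -> 'M[R]_(k.+1, l.+1)) (f0 : 'M[R]_(k.+1, l.+1)) i j :
    f x @[x --> F] --> f0 -> f x i j @[x --> F] --> f0 i j.
  move=> cf; apply: (cvg_comp f (fun A : 'M[R]_(k.+1, l.+1) => A i j) cf).
  exact: coord_continuous.
apply: cvg_sum => i; apply: cvgM; last exact: cc.
by apply: cvg_sum => j; apply: cvgM; exact: cc.
Qed.

Lemma Ck_cst (V W : normedModType R) k (U : set V) (w : W) :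
  Ck k U (fun _ => w).
Proof.
elim: k w => [|k IH] w; split => //; try by move=> x _; exact: cvg_cst.
move=> v; split; first by move=> x _; exact: derivable_cst.
by have -> : 'D_v (fun _ : V => w) = (fun _ => 0) by
  apply/funext => x; exact: derive_cst.
Qed.

Lemma smooth_affine (U : set R) (s v : R) :
  smooth_on U (fun t : R => s + t *: v).
Proof.
move=> k; pose line (t : R) : R := s + t *: v.
apply: (@Ck_subset _ _ _ k (line @^-1` setT)) => //.
apply: (@Ck_line _ R R k setT id).
case: k => [|k]; split => //; try by move=> x _; exact: cvg_id.
move=> w; split; first by move=> x _; exact: derivable_id.
have -> : 'D_w (@id R) = (fun _ => w) by apply/funext => x; exact: derive_id.
exact: Ck_cst.
Qed.

(** The three equations say that the affine maps with coefficients [s, v] and [s', v'] are inverse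
    to each other. *)
Lemma itv_diffeo_affine (a b c d s v s' v' : R) :
  {in `[c, d], forall t, s + t * v \in `[a, b]} ->
  {in `[a, b], forall t, s' + t * v' \in `[c, d]} ->
  v * v' = 1 -> s' + s * v' = 0 -> s + s' * v = 0 ->
  itv_diffeo c d a b (fun t => s + t * v).
Proof.
move=> cdab abcd vv' s1 s2; split.
  by exists 1, (fun t => s + t * v); split => //; exact: smooth_affine.
exists (fun t => s' + t * v').
  by exists 1, (fun t => s' + t * v'); split => //; exact: smooth_affine.
split => // t _.
  by rewrite mulrDl -mulrA vv' mulr1 addrA s1 add0r.
by rewrite mulrDl -mulrA [v' * v]mulrC vv' mulr1 addrA s2 add0r.
Qed.

Lemma itv_diffeo_shift (c d b : R) :
  itv_diffeo b (d - c + b) c d (fun t => (c - b) + t * 1).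
Proof.
apply: (@itv_diffeo_affine _ _ _ _ _ _ (b - c) 1); try lra.
- by move=> t; rewrite !in_itv/= => /andP[? ?]; apply/andP; split; lra.
- by move=> t; rewrite !in_itv/= => /andP[? ?]; apply/andP; split; lra.
Qed.

Lemma itv_diffeo_reverse (a b : R) :
  itv_diffeo a b a b (fun t => (a + b) + t * -1).
Proof.
apply: (@itv_diffeo_affine _ _ _ _ _ _ (a + b) (-1)); try lra.
- by move=> t; rewrite !in_itv/= => /andP[? ?]; apply/andP; split; lra.
- by move=> t; rewrite !in_itv/= => /andP[? ?]; apply/andP; split; lra.
Qed.

End intervals.

(** * Causality in charts: Jacobians, timelike segments, common pasts *)

Section charts.
Context {R : realType} {n : nat} {M : topologicalType} (S : @spacetime R n M).
Implicit Types (c : @chart R n M) (p : M).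

Lemma coord_paramK c z : atlas S c -> chart_img c z ->
  chart_dom c (param c z) /\ coord c (param c z) = z.
Proof.
move=> /atlas_charts[_ _ cK _ _] [p cp <-].
by rewrite cK ?inE.
Qed.

Lemma param_nbhs c p A : atlas S c -> chart_dom c p -> nbhs p A ->
  \forall z \near coord c p, chart_img c z /\ A (param c z).
Proof.
move=> Ac cp pA; have [_ oI cK _ cont] := atlas_charts Ac.
have Ip : chart_img c (coord c p) by exists p.
near=> z; split; first by near: z; exact: open_nbhs_nbhs.
near: z; apply: (cont (coord c p)); first by rewrite inE.
by rewrite cK ?inE.
Unshelve. all: by end_near. Qed.

Lemma overlap_open c c' : atlas S c -> atlas S c' ->
  open (coord c @` (chart_dom c `&` chart_dom c')).
Proof.
move=> Ac Ac'; rewrite openE => _ [p [cp c'p] <-].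
have [oc' _ _ _ _] := atlas_charts Ac'.
apply: filterS (param_nbhs Ac cp (open_nbhs_nbhs (conj oc' c'p))).
by move=> z [/(coord_paramK Ac)[cz zE] c'z]; exists (param c z).
Qed.

(** The Jacobian computes directional derivatives only of differentiable maps, whence the use of
    [C1_differentiable] on the open overlap. *)
Lemma derive_transition c c' p v : atlas S c -> atlas S c' ->
  chart_dom c p -> chart_dom c' p ->
  'D_v (transition c c') (coord c p) = v *m chart_jacobian c c' p.
Proof.
move=> Ac Ac' cp c'p; apply: deriveEjacobian.
apply: C1_differentiable (overlap_open Ac Ac') _ (atlas_smooth Ac Ac' 1%N).
by exists p.
Qed.

Lemma inner_jacobian c c' p u v : atlas S c -> atlas S c' ->
  chart_dom c p -> chart_dom c' p ->
  inner S c' p (u *m chart_jacobian c c' p) (v *m chart_jacobian c c' p) =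
  inner S c p u v.
Proof.
move=> Ac Ac' cp c'p.
by rewrite /inner (metric_tensor Ac Ac' cp c'p) trmx_mul !mulmxA.
Qed.

(** Inner products are independent of the chart. In particular the transformed vector is nonzero,
    since its square is that of [v], which is negative. *)
Lemma timelike_future_vector c c' p v : atlas S c -> atlas S c' ->
  chart_dom c p -> chart_dom c' p ->
  inner S c p v v < 0 -> inner S c p (orientation S c p) v < 0 ->
  future_vector S c' p (v *m chart_jacobian c c' p).
Proof.
move=> Ac Ac' cp c'p vv Xv; rewrite /future_vector /causal_vector.
rewrite (orientation_vector Ac Ac' cp c'p) !inner_jacobian//.
split=> //; split; last exact: ltW.
apply: contraTneq vv => v0; rewrite -(inner_jacobian _ _ Ac Ac' cp c'p) v0.
by rewrite /inner !mul0mx mxE ltxx.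
Qed.

(** The velocity is [v] in the chart [c], hence [v] times the Jacobian in any other chart. The
    margin [e] provides the smooth extension. *)
Lemma future_causal_segment c z v (a b e : R) : atlas S c -> a < b -> 0 < e ->
  (forall t, t \in `]a - e, b + e[ -> chart_img c (z + t *: v)) ->
  (forall t, t \in `[a, b] -> let p := param c (z + t *: v) in
    inner S c p v v < 0 /\ inner S c p (orientation S c p) v < 0) ->
  future_causal S a b (fun t => param c (z + t *: v)).
Proof.
move=> Ac ab e0 Iz vz; split => //.
have [_ _ cK _ cont] := atlas_charts Ac.
have sub c' (I : set R) : I `<=` `]a - e, b + e[ ->
    I `&` (fun t => param c (z + t *: v)) @^-1` chart_dom c' `<=`
    (fun t : R => z + t *: v) @^-1` (coord c @` (chart_dom c `&` chart_dom c')).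
  move=> II t [/II/Iz/(coord_paramK Ac)[ct tE] c't].
  by exists (param c (z + t *: v)).
exists e, (fun t => param c (z + t *: v)); split => //.
  split.
    move=> t; rewrite inE/= => /Iz It.
    apply: (@continuous_comp _ _ _ (fun s : R => z + s *: v) (param c)).
      exact: continuous_line.
    by apply: cont; rewrite inE.
  move=> c' Ac' k; apply: Ck_subset (sub c' _ _) _ => //.
  rewrite -[coord c' \o _]/(transition c c' \o (fun t : R => z + t *: v)).
  by apply: Ck_line; apply: (atlas_smooth Ac Ac').
move=> t c' tab Ac' c't.
have tabe : t \in `]a - e, b + e[.
  move: tab; rewrite !in_itv/= => /andP[? ?]; apply/andP; split; lra.
have [ct tE] := coord_paramK Ac (Iz t tabe).
rewrite -[coord c' \o _]/(transition c c' \o (fun t : R => z + t *: v)).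
rewrite derive_line scale1r.
have := derive_transition v Ac Ac' ct c't; rewrite tE => ->.
by have [vv Xv] := vz t tab; exact: timelike_future_vector.
Qed.

(** At [p] and the orientation vector both quantities equal the negative square of that vector;
    strict inequalities persist nearby by continuity. *)
Lemma orientation_future_near c p : atlas S c -> chart_dom c p ->
  \forall z \near coord c p & v \near orientation S c p,
    let q := param c z in
    inner S c q v v < 0 /\ inner S c q (orientation S c q) v < 0.
Proof.
move=> Ac cp; have [_ oI cK _ cont] := atlas_charts Ac.
have Ip : chart_img c (coord c p) by exists p.
set X := orientation S c p.
have cp' : param c (coord c p) = p by rewrite cK ?inE.
have XX : inner S c p X X < 0 by exact: orientation_timelike.
have cG : (metric S c \o param c) z @[z --> coord c p] --> metric S c p.
  have [+ _] := metric_smooth Ac 0%N.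
  by move/(_ (coord c p)); rewrite inE /continuous_at /= cp'; exact.
have cX : (orientation S c \o param c) z @[z --> coord c p] --> X.
  have := orientation_continuous Ac; move/(_ p); rewrite inE => /(_ cp) cX.
  apply: (cvg_comp (param c) (orientation S c) _ cX).
  have := cont (coord c p); rewrite inE /continuous_at cp'; exact.
(* Both inequalities at once: [f] returns either the vector itself or the orientation at the point,
   and both tend to [X]. *)
have c1 (f : 'rV[R]_n.+1 -> M -> 'rV[R]_n.+1) : 
  f x.2 (param c x.1) @[x --> (coord c p, X)] --> X ->
  \forall x \near (coord c p, X),
   inner S c (param c x.1) (f x.2 (param c x.1)) x.2 < 0.
  have cfst := @cvg_fst _ _ (nbhs (coord c p)) (nbhs X) _.
  have csnd := @cvg_snd _ _ (nbhs (coord c p)) (nbhs X) _.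
  move=> cf; have cI := cvg_form _ cf (csnd _)
    (cvg_comp fst (metric S c \o param c) (cfst _) cG).
  by apply: (cvgr_lt _ (cI _ _ _)); exact: XX.
near=> x; split.
  near: x; apply: (c1 (fun v _ => v)); exact: cvg_snd.
near: x; apply: (c1 (fun _ q => orientation S c q)).
apply: (cvg_comp fst (orientation S c \o param c) _ cX); exact: cvg_fst.
Unshelve. all: by end_near. Qed.

(** In a chart, step back from [p] by a small multiple of the orientation [X]. The segments from
    there to all points close enough to [p] have directions near [X], hence are future-directed. *)
Lemma common_past (p : M) (N : set M) : nbhs p N ->
  exists2 p', N p' & \forall q \near p, exists (a b : R) (gamma : R -> M),
    [/\ future_causal S a b gamma, gamma a = p' & gamma b = q].
Proof.
move=> pN; have [c Ac cp] := atlas_cover S p.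
have [oc _ cK ccont _] := atlas_charts Ac.
set z := coord c p; set X := orientation S c p.
have [[A B] /= [zA XB] ABfut] := orientation_future_near Ac cp.
have : \forall y \near z, A y /\ chart_img c y /\ N (param c y).
  exact: filterI zA (param_nbhs Ac cp pN).
move=> /nbhs_ballP[r1 /= r10 zr1].
have /nbhs_ballP[r2 /= r20 Xr2] : nbhs X B by [].
pose r := Num.min r1 r2.
have r0 : 0 < r by rewrite lt_min r10.
(* Along the extended segments the distance to [z] is at most [2 * d] times the bound of the norm of
   [v], plus [d] times that of [X]; the added 1 makes the final bound by [r] strict. *)
pose D := 3 * `|X| + 2 * r + 1.
have D0 : 0 < D by rewrite /D; have := normr_ge0 X; lra.
pose d := r / D.
have d0 : 0 < d by rewrite divr_gt0.
have dD : d * (3 * `|X| + 2 * r) < r.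
  rewrite -[ltRHS](divfK (lt0r_neq0 D0)) -/d ltr_pM2l// /D; lra.
clearbody d.
have inr1 y : `|y - z| < r -> A y /\ chart_img c y /\ N (param c y).
  move=> yz; apply: zr1; rewrite -ball_normE/= distrC (lt_le_trans yz)//.
  by rewrite ge_min lexx.
pose z0 := z - d *: X.
have [_ [Iz0 Nz0]] : A z0 /\ chart_img c z0 /\ N (param c z0).
  apply: inr1; rewrite /z0 addrAC subrr sub0r normrN normrZ gtr0_norm//.
  apply: le_lt_trans dD; rewrite ler_pM2l//; have := normr_ge0 X; lra.
exists (param c z0) => //.
have : \forall q \near p, chart_dom c q /\ `|z - coord c q| < d * r.
  near=> q; split; first by near: q; exact: open_nbhs_nbhs.
  near: q; have := ccont p; rewrite inE => /(_ cp)/cvgrPdist_lt; apply.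
  by rewrite mulr_gt0.
apply: filterS => q [cq zq].
(* This velocity leads from [z0] to [coord c q] in time [d]. It is [r]-close to [X] because [w] has
   norm less than [d * r]. *)
pose w := coord c q - z; pose v := X + d^-1 *: w.
have wd : `|d^-1 *: w| < r.
  by rewrite normrZ gtr0_norm ?invr_gt0// ltr_pdivrMl// /w distrC.
have vX : `|v| <= `|X| + r.
  by apply: le_trans (ler_normD _ _) _; rewrite lerD2l ltW.
have Bv : B v.
  apply: Xr2; rewrite -ball_normE/= /v opprD addNKr normrN (lt_le_trans wd)//.
  by rewrite ge_min lexx orbT.
have ends : z0 + d *: v = coord c q.
  rewrite /v scalerDr scalerA divff ?gt_eqF// scale1r addrA /z0 subrK.
  by rewrite /w addrC subrK.
have near_z t : t \in `]0 - d, d + d[ -> `|z0 + t *: v - z| < r.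
  rewrite in_itv/= => /andP[t1 t2].
  have td : `|t| <= 2 * d by rewrite ler_norml; apply/andP; split; lra.
  have -> : z0 + t *: v - z = t *: v - d *: X.
    by rewrite /z0 addrAC [z - _]addrC addrK addrC.
  apply: le_lt_trans dD; apply: le_trans (ler_normB _ _) _.
  rewrite !normrZ (gtr0_norm d0).
  apply: (@le_trans _ _ (2 * d * (`|X| + r) + d * `|X|)); last by lra.
  by rewrite lerD2r ler_pM.
exists 0, d, (fun t => param c (z0 + t *: v)); split.
- apply: (@future_causal_segment c z0 v 0 d d) => //.
    by move=> t /near_z/inr1[_ []].
  move=> t; rewrite in_itv/= => /andP[t1 t2].
  apply: (ABfut (z0 + t *: v, v)); split => //=.
  have /near_z/inr1[] // : t \in `]0 - d, d + d[.
  by rewrite in_itv/=; apply/andP; split; lra.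
- by rewrite scale0r addr0.
- by rewrite ends cK ?inE.
Unshelve. all: by end_near. Qed.

End charts.

(** * Piecewise causal paths and their null length as a total variation *)

Section paths.
Context {R : realType} {n : nat} {M : topologicalType} (S : @spacetime R n M).
Implicit Types (a b c d x y : R) (beta gamma : R -> M).

Lemma directed_ext K a b beta gamma : {in `[a, b], beta =1 gamma} ->
  directed_curve S K a b beta -> directed_curve S K a b gamma.
Proof.
move=> bg [ab [e [g [e0 sg gb Kg]]]]; split => //; exists e, g; split => //.
  by move=> t tab; rewrite gb// bg.
by move=> t ch tab Ac; rewrite -bg//; exact: Kg.
Qed.

Lemma directed_sub K a b c d beta : a <= c -> c < d -> d <= b ->
  directed_curve S K a b beta -> directed_curve S K c d beta.
Proof.
move=> ac cd db [ab [e [g [e0 [cg sg] gb Kg]]]]; split => //.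
have sub : `]c - e, d + e[ `<=` `]a - e, b + e[%classic.
  by move=> t /=; rewrite !in_itv/= => /andP[? ?]; apply/andP; split; lra.
have sub' t : t \in `[c, d] -> t \in `[a, b].
  by rewrite !in_itv/= => /andP[? ?]; apply/andP; split; lra.
exists e, g; split => //.
- split; first by move=> t; rewrite inE => /sub tI; apply: cg; rewrite inE.
  move=> ch Ac k; apply: Ck_subset (sg ch Ac k).
  by move=> t [/sub].
- by move=> t /sub'; exact: gb.
- by move=> t ch /sub'; exact: Kg.
Qed.

Lemma directed_continuous K a b beta :
  directed_curve S K a b beta -> {within `[a, b], continuous beta}.
Proof.
move=> [ab [e [g [e0 [cg _] gb _]]]].
have -> : {within `[a, b], continuous beta} = {within `[a, b], continuous g}.
  apply/propext; split; apply: subspace_eq_continuous => t; rewrite inE/=;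
  by move=> /gb.
apply: continuous_in_subspaceT => t; rewrite inE/= => tab; apply: cg.
rewrite inE/=; move: tab; rewrite !in_itv/= => /andP[? ?].
by apply/andP; split; lra.
Qed.

Definition causal_piece beta x y :=
  future_causal S x y beta \/ past_causal S x y beta.

Definition causal_on beta a b := exists s, causal_partition S beta a b s.

Lemma causal_partition_cons beta a b x s :
  causal_partition S beta a b (x :: s) <->
  causal_piece beta a x /\ causal_partition S beta x b s.
Proof.
split=> [[abs cs]|[cx [[xs /eqP <-] cs]]].
  split; first exact: (cs 0%N isT).
  by split; [exact: itv_partition_cons abs|move=> i si; exact: (cs i.+1)].
split; last by case=> [|i] si //=; exact: cs.
by split => //=; rewrite xs andbT; case: cx => -[].
Qed.

Lemma causal_on_refl beta a : causal_on beta a a.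
Proof. by exists [::]; split => //; split. Qed.

Lemma causal_on_piece beta x y : causal_piece beta x y -> causal_on beta x y.
Proof.
move=> xy; exists [:: y]; apply/causal_partition_cons; split => //.
Qed.

Lemma causal_on_cat beta a b c :
  causal_on beta a c -> causal_on beta c b -> causal_on beta a b.
Proof.
move=> [s]; elim: s a => [a [/itv_partition_nil->]//|x s IH a].
move=> /causal_partition_cons[ax xc] cb; have [t xt] := IH _ xc cb.
by exists (x :: t); apply/causal_partition_cons.
Qed.

Lemma causal_on_le beta a b : causal_on beta a b -> a <= b.
Proof. by move=> [s [/itv_partition_le]]. Qed.

Lemma causal_piece_lt beta a b : causal_piece beta a b -> a < b.
Proof. by case=> -[]. Qed.

(** Replaces explicit partitions in later proofs: a property of intervals that holds on points and
    on causal pieces and passes to adjacent unions holds on the whole interval. *)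
Lemma causal_on_ind (P : R -> R -> Prop) beta a b :
  (forall x, a <= x -> x <= b -> P x x) ->
  (forall x y, a <= x -> y <= b -> causal_piece beta x y -> P x y) ->
  (forall x y z, a <= x -> x <= y -> y <= z -> z <= b ->
     P x y -> P y z -> P x z) ->
  causal_on beta a b -> P a b.
Proof.
move=> P0 P1 P2; suff H s x : a <= x -> causal_partition S beta x b s -> P x b.
  by move=> [s]; exact: H.
elim: s x => [x ax [/itv_partition_nil xb _]|y s IH x ax].
  by rewrite -xb; apply: P0; rewrite // xb.
move=> /causal_partition_cons[xy yb].
have lexy := ltW (causal_piece_lt xy).
have leyb : y <= b by apply: (@causal_on_le beta); exists s.
apply: (P2 _ y) => //; first exact: P1.
by apply: IH => //; exact: le_trans lexy.
Qed.

Lemma causal_on_ext beta gamma a b : {in `[a, b], beta =1 gamma} ->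
  causal_on beta a b -> causal_on gamma a b.
Proof.
move=> bg; apply: causal_on_ind => [x _ _|x y ax yb xy|x y z _ _ _ _].
- exact: causal_on_refl.
- apply: causal_on_piece.
  have bgxy : {in `[x, y], beta =1 gamma}.
    move=> t; rewrite in_itv/= => /andP[xt ty]; apply: bg.
    by rewrite in_itv/= (le_trans ax xt) (le_trans ty yb).
  by case: xy => [?|?]; [left|right]; apply: directed_ext bgxy _.
- exact: causal_on_cat.
Qed.

(** The claim for all subintervals at once is proved by induction; when two intervals are joined at
    [y], the subinterval lies on one side of [y] or is cut there. *)
Lemma causal_on_restrict beta a b c d : causal_on beta a b ->
  a <= c -> c <= d -> d <= b -> causal_on beta c d.
Proof.
move=> ab; move: c d.
apply: (@causal_on_ind (fun x y => forall c d, x <= c -> c <= d -> d <= y ->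
  causal_on beta c d) beta a b) ab
  => [x _ _ c d|x y _ _ xy c d|x y z _ xy yz _].
- move=> xc cd dx; have -> : c = d by apply/le_anti; rewrite cd (le_trans dx).
  exact: causal_on_refl.
- move=> xc; rewrite le_eqVlt => /predU1P[-> _|cd dy].
    exact: causal_on_refl.
  apply: causal_on_piece.
  by case: xy => [?|?]; [left|right]; exact: (directed_sub xc cd dy).
- move=> Pxy Pyz c d xc cd dz.
  have [dy|/ltW yd] := leP d y; first exact: Pxy.
  have [yc|/ltW cy] := leP y c; first exact: Pyz.
  by apply: (@causal_on_cat _ _ _ y); [exact: Pxy|exact: Pyz].
Qed.

Lemma concat_pathl c beta gamma a :
  {in `[a, c], beta =1 concat_path c beta gamma}.
Proof. by move=> t; rewrite in_itv/= /concat_path => /andP[_ ->]. Qed.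

Lemma concat_pathr c beta gamma b : beta c = gamma c ->
  {in `[c, b], gamma =1 concat_path c beta gamma}.
Proof.
move=> bgc t; rewrite in_itv/= /concat_path => /andP[ct _].
by case: ifPn => // tc; have -> : t = c by apply/le_anti; rewrite tc.
Qed.

Lemma piecewise_causal_concat a b c beta gamma :
  piecewise_causal S a c beta -> piecewise_causal S c b gamma ->
  beta c = gamma c -> piecewise_causal S a b (concat_path c beta gamma).
Proof.
move=> [cb ac] [cg bc] bgc; split; last first.
  apply: (@causal_on_cat _ _ _ c).
    by apply: causal_on_ext ac; exact: concat_pathl.
  by apply: causal_on_ext bc; exact: concat_pathr.
have ac' := causal_on_le ac; have bc' := causal_on_le bc.
have -> : `[a, b]%classic = `[a, c] `|` `[c, b].
  apply/seteqP; split => t /=; rewrite !in_itv/=.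
    move=> /andP[at_ tb]; have [tc|/ltW ct] := leP t c.
      by left; rewrite at_.
    by right; rewrite ct tb.
  by move=> [/andP[? ?]|/andP[? ?]]; apply/andP; split; lra.
apply: withinU_continuous => //; try exact: interval_closed.
  apply: subspace_eq_continuous cb => t; rewrite inE; exact: concat_pathl.
apply: subspace_eq_continuous cg => t; rewrite inE; exact: concat_pathr.
Qed.

Lemma null_length_total_variation tau a b beta : time_function S tau ->
  causal_on beta a b ->
  (null_length S tau a b beta)%:E = total_variation a b (tau \o beta).
Proof.
move=> tauS [s cs]; rewrite (null_lengthE tauS cs).
by rewrite (variation_causal_partition tauS cs).
Qed.

(** The cut [c] may lie inside a causal piece; total variation is additive at every point. *)
Lemma null_length_additive tau a b c beta : time_function S tau ->
  causal_on beta a b -> a <= c -> c <= b ->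
  null_length S tau a b beta =
  null_length S tau a c beta + null_length S tau c b beta.
Proof.
move=> tauS ab ac cb; apply: EFin_inj; rewrite EFinD.
rewrite !null_length_total_variation//; first exact: total_variationD.
  exact: (causal_on_restrict ab).
exact: (causal_on_restrict ab).
Qed.

Lemma null_length_ge0 tau a b beta : 0 <= null_length S tau a b beta.
Proof. exact: variation_ge0. Qed.

(** [null_length] selects a partition, so the comparison is made between total variations, piece by
    piece. *)
Lemma null_length_ext tau a b beta gamma : time_function S tau ->
  causal_on beta a b -> {in `[a, b], beta =1 gamma} ->
  null_length S tau a b beta = null_length S tau a b gamma.
Proof.
move=> tauS ab bg; apply: EFin_inj.
rewrite !null_length_total_variation//; last exact: causal_on_ext ab.
apply: (@causal_on_ind (fun x y => total_variation x y (tau \o beta) =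
  total_variation x y (tau \o gamma)) beta a b) ab
    => [x _ _|x y ax yb xy|x y z _ xy yz _ Exy Eyz].
- by rewrite !total_variationxx.
- have bgxy : {in `[x, y], beta =1 gamma}.
    move=> t; rewrite in_itv/= => /andP[xt ty]; apply: bg.
    by rewrite in_itv/= (le_trans ax xt) (le_trans ty yb).
  have lexy := ltW (causal_piece_lt xy).
  rewrite (total_variation_causal tauS xy).
  rewrite (@total_variation_causal _ _ _ S)//; last first.
    by case: xy => [?|?]; [left|right]; apply: directed_ext bgxy _.
  by rewrite !bgxy// in_itv/= lexx lexy.
- by rewrite !(total_variationD _ xy yz) Exy Eyz.
Qed.

End paths.

(** * Reparametrization invariance and continuity of the null length *)

Section reparam.
Context {R : realType} {n : nat} {M : topologicalType} (S : @spacetime R n M).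
Implicit Types (a b c d x y : R) (beta gamma : R -> M).

Lemma innerZl (ch : chart n M) p (s : R) u v :
  inner S ch p (s *: u) v = s * inner S ch p u v.
Proof. by rewrite /inner -!scalemxAl [LHS]mxE. Qed.

Lemma innerZr (ch : chart n M) p (s : R) u v :
  inner S ch p u (s *: v) = s * inner S ch p u v.
Proof. by rewrite /inner linearZ/= -scalemxAr [LHS]mxE. Qed.

Lemma causal_vectorZ (ch : chart n M) p (s : R) v : s != 0 ->
  causal_vector S ch p v -> causal_vector S ch p (s *: v).
Proof.
move=> s0 [v0 vv]; split; first by rewrite scaler_eq0 negb_or s0.
by rewrite innerZl innerZr mulrA -expr2 pmulr_rle0// exprn_even_gt0.
Qed.

Lemma future_vectorZ_gt0 (ch : chart n M) p (s : R) v : 0 < s ->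
  future_vector S ch p v -> future_vector S ch p (s *: v).
Proof.
move=> s0 [vv Xv]; split; first by apply: causal_vectorZ; rewrite ?gt_eqF.
by rewrite innerZr pmulr_rlt0.
Qed.

Lemma past_vectorZ_gt0 (ch : chart n M) p (s : R) v : 0 < s ->
  past_vector S ch p v -> past_vector S ch p (s *: v).
Proof.
move=> s0 [vv Xv]; split; first by apply: causal_vectorZ; rewrite ?gt_eqF.
by rewrite innerZr mulr_gt0.
Qed.

Lemma future_vectorZ_lt0 (ch : chart n M) p (s : R) v : s < 0 ->
  future_vector S ch p v -> past_vector S ch p (s *: v).
Proof.
move=> s0 [vv Xv]; split; first by apply: causal_vectorZ; rewrite ?lt_eqF.
by rewrite innerZr nmulr_rgt0.
Qed.

Lemma past_vectorZ_lt0 (ch : chart n M) p (s : R) v : s < 0 ->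
  past_vector S ch p v -> future_vector S ch p (s *: v).
Proof.
move=> s0 [vv Xv]; split; first by apply: causal_vectorZ; rewrite ?lt_eqF.
by rewrite innerZr nmulr_rlt0.
Qed.

(** The velocity gets multiplied by the derivative of [phi]. Two cones [K] and [K'] cover the
    positive case, where time orientation is kept, and the negative one, where it is reversed. *)
Lemma directed_comp (K K' : chart n M -> M -> 'rV[R]_n.+1 -> Prop)
    beta x y (phi : R -> R) (J : set R) c d :
  directed_curve S K x y beta ->
  open J -> smooth_on J phi -> c < d -> `[c, d] `<=` J ->
  (forall t, t \in `[c, d] -> phi t \in `[x, y]) ->
  (forall t ch p v, t \in `[c, d] -> K ch p v -> K' ch p ('D_1 phi t *: v)) ->
  directed_curve S K' c d (beta \o phi).
Proof.
move=> [xy [e [g [e0 [cg sg] gb Kg]]]] oJ sphi cd cdJ phixy KK; split => //.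
pose I : set R := `]x - e, y + e[%classic.
pose J' := J `&` phi @^-1` I.
have [cphi _] := sphi 0%N.
have oJ' : open J' by apply: open_setI_preimage => //; exact: interval_open.
have xyI t : t \in `[x, y] -> I t.
  by rewrite /I/= !in_itv/= => /andP[? ?]; apply/andP; split; lra.
have cdJ' t : t \in `[c, d] -> J' t.
  by move=> tcd; split; [exact: cdJ|exact/xyI/phixy].
have nearJ' t : t \in `[c, d] -> exists2 r : R, 0 < r & ball t r `<=` J'.
  move=> /cdJ' J't.
  have /nbhs_ballP[r /= r0 rJ] : nbhs t J' by exact: open_nbhs_nbhs.
  by exists r.
(* The open set [J'] contains the closed interval, so balls at its two ends give the margin of the
   smooth extension. *)
have [|r1 r10 r1J] := nearJ' c; first by rewrite in_itv/= lexx ltW.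
have [|r2 r20 r2J] := nearJ' d; first by rewrite in_itv/= lexx ltW.
pose r := Num.min r1 r2.
have r0 : 0 < r by rewrite lt_min r10.
have rJ : `]c - r, d + r[ `<=` J'.
  have [rr1 rr2] : r <= r1 /\ r <= r2 by split; rewrite ge_min lexx ?orbT.
  move=> t /=; rewrite in_itv/= => /andP[ct td].
  have [tc|ct'] := ltP t c.
    by apply: r1J; rewrite /ball/= ltr_norml; apply/andP; split; lra.
  have [dt|td'] := ltP d t.
    by apply: r2J; rewrite /ball/= ltr_norml; apply/andP; split; lra.
  by apply: cdJ'; rewrite in_itv/= ct'.
exists r, (g \o phi); split => //.
- split.
    move=> t; rewrite inE => /rJ[Jt It]; apply: continuous_comp.
      by apply: cphi; rewrite inE.
    by apply: cg; rewrite inE.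
  move=> ch Ac k.
  have cgp : {in `]c - r, d + r[%classic, continuous (g \o phi)}.
    move=> t; rewrite inE => /rJ[Jt It]; apply: continuous_comp.
      by apply: cphi; rewrite inE.
    by apply: cg; rewrite inE.
  have [och _ _ _ _] := atlas_charts Ac.
  apply: (@Ck_comp _ _ k (I `&` g @^-1` chart_dom ch) _ phi (coord ch \o g)).
  + by apply: open_setI_preimage => //; exact: interval_open.
  + by move=> t [/rJ[_ It]].
  + by apply: Ck_subset (sphi k) => t [/rJ[]].
  + exact: sg.
- by move=> t tcd; rewrite /= gb//; exact: phixy.
- move=> t ch tcd Ac cht.
  have pI : (I `&` g @^-1` chart_dom ch) (phi t).
    by split; [exact/xyI/phixy|rewrite /= gb//; exact: phixy].
  rewrite -[_ \o (g \o phi)]/((coord ch \o g) \o phi) derive_compR.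
  + by apply: KK => //; exact: Kg (phixy _ tcd) Ac cht.
  + exact: Ck_differentiable (sphi 1%N) (cdJ _ tcd).
  + exact: Ck_differentiable (sg ch Ac 1%N) pI.
Qed.

(** The inverse [psi] carries a causal partition of the interval from [a] to [b] over to one from
    [c] to [d]. On a piece the variation of [tau] depends only on the endpoints, which [phi]
    matches. *)
Lemma causal_reparam tau beta a b c d phi : time_function S tau ->
  itv_diffeo c d a b phi -> causal_on S beta a b ->
  causal_on S (beta \o phi) c d /\
  total_variation c d (tau \o (beta \o phi)) =
  total_variation a b (tau \o beta).
Proof.
move=> tauS [[e [f [e0 sf fphi]]] [psi [e' [h [e'0 sh hpsi]]]]].
move=> [phiab psicd phiK psiK] ab; have leab := causal_on_le ab.
have aab : a \in `[a, b] by rewrite in_itv/= lexx.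
have bab : b \in `[a, b] by rewrite in_itv/= lexx andbT.
have lecd : c <= d.
  by move: (psicd _ aab); rewrite in_itv/= => /andP[]; exact: le_trans.
have ccd : c \in `[c, d] by rewrite in_itv/= lexx.
have dcd : d \in `[c, d] by rewrite in_itv/= lexx andbT.
move: (lecd); rewrite le_eqVlt => /predU1P[cd|cd].
  have ab1 : a = b by rewrite -(psiK a)// -(psiK b)//; congr phi;
    move: (psicd _ aab) (psicd _ bab); rewrite cd => /itvxxP-> /itvxxP->.
  by rewrite -ab1 -cd !total_variationxx; split => //; exact: causal_on_refl.
pose J : set R := `]c - e, d + e[%classic.
have oJ : open J by exact: interval_open.
have cdJ : `[c, d] `<=` J.
  by move=> t; rewrite /J/= !in_itv/= => /andP[? ?]; apply/andP; split; lra.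
have fab t : t \in `[c, d] -> f t \in `[a, b].
  by move=> tcd; rewrite fphi//; exact: phiab.
have D0 t : t \in `[c, d] -> 'D_1 f t != 0.
  apply: (smooth_itv_derive_neq0 cd e0 e'0 sf sh) => //.
  by move=> s scd /=; rewrite fphi// hpsi ?phiK//; exact: phiab.
have df t : t \in `]c, d[ -> derivable f t 1.
  move=> tcd; apply: (Ck_derivable (sf 1%N)); apply: cdJ.
  by apply: subset_itvW tcd; rewrite lexx.
have cf : {within `[c, d], continuous f}.
  apply: continuous_in_subspaceT => t; rewrite inE => /cdJ Jt.
  by have [+ _] := sf 0%N; apply; rewrite inE.
have oo_cc t : t \in `]c, d[ -> t \in `[c, d] by apply: subset_itv_oo_cc.
have sub_ab x y t : a <= x -> y <= b -> t \in `[x, y] -> t \in `[a, b].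
  by move=> ax yb; rewrite !in_itv/= => /andP[? ?]; apply/andP; split; lra.
have sub_cd x y t : x \in `[c, d] -> y \in `[c, d] -> t \in `[x, y] ->
    t \in `[c, d].
  by rewrite !in_itv/= => /andP[? ?] /andP[? ?] /andP[? ?];
    apply/andP; split; lra.
have fphi_ext x y : x \in `[c, d] -> y \in `[c, d] ->
    {in `[x, y], beta \o f =1 beta \o phi}.
  by move=> xcd ycd t txy; rewrite /= fphi//; exact: sub_cd txy.
(* If [phi] increases, so does [psi], and pieces keep their time orientation. If it decreases,
   endpoints are exchanged and future and past pieces are swapped. *)
have [Dpos|Dneg] := derive_sign sf cdJ cd D0.
- have phi_inc : {in `[c, d] &, {mono phi : s t / s <= t}}.
    apply: le_mono_in => s t scd tcd st; rewrite -!fphi//.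
    apply: (gtr0_derive1_lt_cc df _ cf) => // u /oo_cc ucd.
    by rewrite derive1E; exact: Dpos.
  have psi_inc : {in `[a, b] &, {mono psi : x y / x <= y}}.
    move=> x y xab yab; rewrite -[in RHS](psiK x)// -[in RHS](psiK y)//.
    by rewrite phi_inc//; exact: psicd.
  have psia : psi a = c.
    apply/le_anti.
    have /andP[-> _] : c <= psi a <= d by move: (psicd _ aab); rewrite in_itv.
    rewrite andbT -phi_inc ?psicd// psiK//.
    by move: (phiab _ ccd); rewrite in_itv/= => /andP[].
  have psib : psi b = d.
    apply/le_anti.
    have /andP[_ ->] : c <= psi b <= d by move: (psicd _ bab); rewrite in_itv.
    rewrite /= -phi_inc ?psicd// psiK//.
    by move: (phiab _ dcd); rewrite in_itv/= => /andP[].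
  rewrite -psia -psib.
  pose P x y := causal_on S (beta \o phi) (psi x) (psi y) /\
    total_variation (psi x) (psi y) (tau \o (beta \o phi)) =
    total_variation x y (tau \o beta).
  apply: (@causal_on_ind _ _ _ _ P) ab
    => [x _ _|x y ax yb xy|x y z ax xy yz zb].
  + by split; rewrite ?total_variationxx//; exact: causal_on_refl.
  + have ltxy := causal_piece_lt xy.
    have xab : x \in `[a, b] by rewrite in_itv/= ax (le_trans (ltW ltxy)).
    have yab : y \in `[a, b] by rewrite in_itv/= yb (le_trans ax (ltW ltxy)).
    have [xcd ycd] := (psicd _ xab, psicd _ yab).
    have ltpsi : psi x < psi y by rewrite (leW_mono_in psi_inc).
    have fxy t : t \in `[psi x, psi y] -> f t \in `[x, y].
      move=> txy; have tcd := sub_cd _ _ _ xcd ycd txy; rewrite fphi//.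
      move: txy; rewrite !in_itv/= -(psiK x)// -(psiK y)//.
      by rewrite !phi_inc ?psiK.
    have comp K K' := @directed_comp K K' beta x y f J (psi x) (psi y).
    have xycd : `[psi x, psi y] `<=` J.
      by move=> t txy; apply: cdJ; exact: sub_cd txy.
    have piece : causal_piece S (beta \o phi) (psi x) (psi y).
      case: xy => xy; [left|right];
        apply: directed_ext (fphi_ext _ _ xcd ycd) _.
        apply: (comp _ _ xy) => //.
        move=> t ch p v txy; apply: future_vectorZ_gt0; apply: Dpos.
        exact: sub_cd txy.
      apply: (comp _ _ xy) => //.
      move=> t ch p v txy; apply: past_vectorZ_gt0; apply: Dpos.
      exact: sub_cd txy.
    split; first exact: causal_on_piece.
    rewrite (total_variation_causal tauS piece).
    by rewrite (total_variation_causal tauS xy)/= !psiK.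
  + move=> [Cxy Txy] [Cyz Tyz]; split; first exact: causal_on_cat Cxy Cyz.
    rewrite (total_variationD _ (causal_on_le Cxy) (causal_on_le Cyz)).
    by rewrite Txy Tyz -total_variationD.
- have phi_dec : {in `[c, d] &, {mono phi : s t /~ s <= t}}.
    apply: le_nmono_in => s t scd tcd st; rewrite -!fphi//.
    apply: (ltr0_derive1_lt_cc df _ cf) => // u /oo_cc ucd.
    by rewrite derive1E; exact: Dneg.
  have psi_dec : {in `[a, b] &, {mono psi : x y /~ x <= y}}.
    move=> x y xab yab; rewrite -[in RHS](psiK x)// -[in RHS](psiK y)//.
    by rewrite phi_dec//; exact: psicd.
  have psia : psi a = d.
    apply/le_anti.
    have /andP[_ ->] : c <= psi a <= d by move: (psicd _ aab); rewrite in_itv.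
    rewrite /= -phi_dec ?psicd// psiK//.
    by move: (phiab _ dcd); rewrite in_itv/= => /andP[].
  have psib : psi b = c.
    apply/le_anti.
    have /andP[-> _] : c <= psi b <= d by move: (psicd _ bab); rewrite in_itv.
    rewrite andbT -phi_dec ?psicd// psiK//.
    by move: (phiab _ ccd); rewrite in_itv/= => /andP[].
  rewrite -psia -psib.
  pose P x y := causal_on S (beta \o phi) (psi y) (psi x) /\
    total_variation (psi y) (psi x) (tau \o (beta \o phi)) =
    total_variation x y (tau \o beta).
  apply: (@causal_on_ind _ _ _ _ P) ab
    => [x _ _|x y ax yb xy|x y z ax xy yz zb].
  + by split; rewrite ?total_variationxx//; exact: causal_on_refl.
  + have ltxy := causal_piece_lt xy.
    have xab : x \in `[a, b] by rewrite in_itv/= ax (le_trans (ltW ltxy)).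
    have yab : y \in `[a, b] by rewrite in_itv/= yb (le_trans ax (ltW ltxy)).
    have [xcd ycd] := (psicd _ xab, psicd _ yab).
    have ltpsi : psi y < psi x by rewrite (leW_nmono_in psi_dec).
    have fxy t : t \in `[psi y, psi x] -> f t \in `[x, y].
      move=> txy; have tcd := sub_cd _ _ _ ycd xcd txy; rewrite fphi//.
      move: txy; rewrite !in_itv/= -(psiK x)// -(psiK y)//.
      by rewrite !phi_dec ?psiK// andbC.
    have comp K K' := @directed_comp K K' beta x y f J (psi y) (psi x).
    have xycd : `[psi y, psi x] `<=` J.
      by move=> t txy; apply: cdJ; exact: sub_cd txy.
    have piece : causal_piece S (beta \o phi) (psi y) (psi x).
      case: xy => xy; [right|left];
        apply: directed_ext (fphi_ext _ _ ycd xcd) _.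
        apply: (comp _ _ xy) => //.
        move=> t ch p v txy; apply: future_vectorZ_lt0; apply: Dneg.
        exact: sub_cd txy.
      apply: (comp _ _ xy) => //.
      move=> t ch p v txy; apply: past_vectorZ_lt0; apply: Dneg.
      exact: sub_cd txy.
    split; first exact: causal_on_piece.
    rewrite (total_variation_causal tauS piece).
    by rewrite (total_variation_causal tauS xy)/= !psiK// distrC.
  + move=> [Cxy Txy] [Cyz Tyz]; split; first exact: causal_on_cat Cyz Cxy.
    rewrite (total_variationD _ (causal_on_le Cyz) (causal_on_le Cxy)).
    by rewrite Txy Tyz addeC -total_variationD.
Qed.

(** The variation function of a continuous function of bounded variation is continuous; here the
    variation is finite, being the null length. *)
Lemma null_length_continuous tau a b beta : time_function S tau ->
  piecewise_causal S a b beta ->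
  {within `[a, b], continuous (fun t => (null_length S tau a t beta)%:E)}.
Proof.
move=> tauS [cb ab]; have := causal_on_le ab.
rewrite le_eqVlt => /predU1P[<-|ltab].
  by rewrite set_itv1; exact: continuous_subspace1.
have ct : {within `[a, b], continuous (tau \o beta)}.
  move=> t; apply: (@continuous_comp (subspace `[a, b]) _ _ beta tau).
    exact: cb.
  exact: tauS.1.
have bv : bounded_variation a b (tau \o beta).
  apply/bounded_variationP; first exact: ltW.
  by rewrite -(null_length_total_variation tauS ab).
apply: (@subspace_eq_continuous _ _ _
    (EFin \o (fine \o (total_variation a ^~ (tau \o beta))))).
  move=> t; rewrite inE/= in_itv/= => /andP[at_ tb].
  rewrite -(null_length_total_variation tauS) //.
  exact: causal_on_restrict ab _ _ _.
move=> t; apply: (@continuous_comp (subspace `[a, b]) R (\bar R)).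
  exact: (total_variation_continuous ltab ct bv).
by apply/fine_cvgP; split; [exact: nearW|exact: cvg_id].
Qed.

End reparam.

(** * A positive lower bound for the length of paths leaving a neighborhood *)

Section exit.
Context {R : realType} {n : nat} {M : topologicalType} (S : @spacetime R n M).
Context (tau : M -> R) (tau_time : time_function S tau).
Implicit Types (a b : R) (beta gamma : R -> M).

(** The anti-Lipschitz bound holds on each causal piece, after reversal if it is past-directed; the
    triangle inequality adds the pieces up. *)
Lemma dist_le_null_length (U : set M) (d : M -> M -> R) beta a b :
  distance_on U d ->
  (forall p q, U p -> U q -> causal_le S p q -> d p q <= tau q - tau p) ->
  causal_on S beta a b -> (forall t, a <= t -> t <= b -> U (beta t)) ->
  d (beta a) (beta b) <= null_length S tau a b beta.
Proof.
move=> [_ d0 dC dD] dtau ab Ub.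
rewrite -lee_fin (null_length_total_variation tau_time ab).
apply: (@causal_on_ind _ _ _ _ (fun x y => (d (beta x) (beta y))%:E <=
  total_variation x y (tau \o beta))%E) ab
  => [x ax xb|x y ax yb xy|x y z ax xy yz zb].
- rewrite total_variationxx lee_fin; have Ux := Ub x ax xb.
  by have [_ ->] := d0 _ _ Ux Ux.
- have ltxy := causal_piece_lt xy.
  have Ux : U (beta x) by apply: Ub => //; rewrite (le_trans (ltW ltxy)).
  have Uy : U (beta y) by apply: Ub => //; rewrite (le_trans ax (ltW ltxy)).
  rewrite (total_variation_causal tau_time xy)/= lee_fin.
  case: xy => xy.
    apply: le_trans (ler_norm _); apply: dtau => //.
    by right; exists x, y, beta.
  rewrite distrC dC//; apply: le_trans (ler_norm _); apply: dtau => //.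
  right; exists x, y, (beta \o (fun t => x + y - t)).
  split; first exact: past_causal_reflect.
    by rewrite /= addrAC subrr add0r.
  by rewrite /= addrK.
- move=> dxy dyz; rewrite (total_variationD _ xy yz).
  apply: le_trans (leeD dxy dyz); rewrite -EFinD lee_fin.
  by apply: dD; apply: Ub; lra.
Qed.

(* The distance d need not be related to the topology of M; a common causal
   predecessor x of q and q' close to q bounds d q q' by values of tau. *)
Lemma dist_near0 (U : set M) (d : M -> M -> R) q (e : R) :
  distance_on U d ->
  (forall p q, U p -> U q -> causal_le S p q -> d p q <= tau q - tau p) ->
  nbhs q U -> 0 < e -> \forall q' \near q, U q' /\ d q q' < e.
Proof.
move=> [_ _ dC dD] dtau qU e0.
(* With [tau] within [e / 3] of [tau q] at both [x] and [q'], the distances from [x] to [q] and to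
   [q'] are below [e / 3] and [2 * e / 3]. *)
have e30 : 0 < e / 3 by lra.
have tau_q : \forall x \near q, `|tau q - tau x| < e / 3.
  by have /cvgrPdist_lt := tau_time.1 q; apply.
have [x [Ux xe] qx] := common_past S (filterI qU tau_q).
have dx q' : U q' -> (exists (a b : R) gamma,
    [/\ future_causal S a b gamma, gamma a = x & gamma b = q']) ->
    d x q' <= tau q' - tau x.
  move=> Uq' [a [b [g [fg ga gb]]]]; apply: dtau => //.
  by right; exists a, b, g.
have Uq := nbhs_singleton qU.
have dqx := dx q Uq (nbhs_singleton qx).
near=> q'.
have Uq' : U q' by near: q'.
split => //; have dq'x : d x q' <= tau q' - tau x by apply: dx => //; near: q'.
have q'e : `|tau q - tau q'| < e / 3 by near: q'.
apply: le_lt_trans (dD q x q' Uq Ux Uq') _; rewrite (dC q)//.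
move: xe q'e; rewrite /= !ltr_norml => /andP[? ?] /andP[? ?]; lra.
Unshelve. all: by end_near. Qed.

Lemma null_length_exit (tau_anti : locally_anti_lipschitz S tau) (p : M)
    (U : set M) : nbhs p U ->
  exists2 e : R, 0 < e & forall a b beta, piecewise_causal S a b beta ->
    beta a = p -> ~ U (beta b) -> e <= null_length S tau a b beta.
Proof.
move=> pU; have [V pV [d dV dtau]] := tau_anti p.
have [c Ac cp] := atlas_cover S p.
have [oc _ cK ccont pcont] := atlas_charts Ac.
set z := coord c p.
have : nbhs p (U `&` V°) by apply: filterI => //; exact: nbhs_interior.
move=> /(param_nbhs Ac cp)/nbhs_ballP[r0 /= r00 r0W].
(* Halving makes the closed ball of radius [r] fit in the open ball of radius [r0]. *)
pose r := r0 / 2.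
have r0' : 0 < r by rewrite /r; lra.
pose B : set 'rV[R]_n.+1 := [set y | `|z - y| <= r].
have BW (y : 'rV[R]_n.+1) : B y -> chart_img c y /\ (U `&` V°) (param c y).
  move=> yB; apply: r0W; rewrite -ball_normE/=; apply: le_lt_trans yB _.
  by rewrite /r; lra.
have cB : compact B.
  apply: bounded_closed_compact.
    exists (`|z| + r); split; first exact: num_real.
    move=> m mr y /= yB; rewrite (le_trans _ (ltW mr))//.
    rewrite -[y](subKr z) (le_trans (ler_normB _ _))//.
    by rewrite lerD2l.
  by have := @closed_closed_ball_ R _ z r; apply.
pose K := param c @` B.
have cptK : compact K.
  apply: continuous_compact => //.
  apply: continuous_in_subspaceT => y; rewrite inE => /BW[Iy _].
  by apply: pcont; rewrite inE.
have KW q : K q -> (U `&` V°) q by move=> [y /BW[_ ?] <-].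
pose O := chart_dom c `&` coord c @^-1` ball z r.
have oO : open O.
  rewrite openE => q [cq zq]; apply: filterI; first exact: open_nbhs_nbhs.
  apply: (ccont q); first by rewrite inE.
  by apply: open_nbhs_nbhs; split => //; exact: ball_open.
have OK : O `<=` K.
  move=> q [cq]; rewrite /= -ball_normE/= => zq.
  by exists (coord c q); [exact: ltW|rewrite cK ?inE].
have closK : closed K by exact: compact_closed (spacetime_hausdorff S) cptK.
have cOK : closure O `<=` K.
  by rewrite [X in _ `<=` X](closure_id _).1//; exact: closureS.
have Op : O p by split => //; exact: ballxx.
(* This is the coordinate sphere. A path starting in [O] meets it on first leaving [O], because the
   closure of [O] lies in the closed set [K]. *)
pose Sg := K `&` ~` O.
have cSg : compact Sg by apply: compact_closedI => //; exact: open_closedC.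
have Vp : V p := nbhs_singleton pV.
have KV q : K q -> nbhs q V by move=> /KW[_].
have [e e0 eS] : exists2 e : R, 0 < e & forall q, Sg q -> e <= d p q.
  (* On an empty sphere any positive bound will do; otherwise [d p] attains its minimum, which is
     positive because [p] is in [O]. *)
  have [[q0 Sq0]|Sg0] := pselect (Sg !=set0); last first.
    by exists 1 => // q Sq; case: Sg0; exists q.
  have cd : {within Sg, continuous (d p)}.
    apply: continuous_in_subspaceT => q; rewrite inE => -[Kq _].
    apply/cvgrPdist_lt => e e0.
    have Vq := nbhs_singleton (KV q Kq).
    apply: filterS (dist_near0 dV dtau (KV q Kq) e0) => q' [Vq' dqq'].
    have [_ _ dC dD] := dV.
    have := dD _ _ _ Vp Vq Vq'; have := dD _ _ _ Vp Vq' Vq.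
    rewrite (dC q' q)// => h1 h2; rewrite ltr_norml; apply/andP; split; lra.
  have [q1 Sq1 q1min] := compact_EVT_min (ex_intro _ q0 Sq0) cSg cd.
  move: Sq1; rewrite inE => -[Kq1 nOq1].
  have Vq1 := nbhs_singleton (KV _ Kq1).
  exists (d p q1); last by move=> q Sq; apply: q1min; rewrite inE.
  have [dge0 d0 _ _] := dV; rewrite lt_neqAle dge0// andbT eq_sym.
  by apply/eqP => /(d0 _ _ Vp Vq1) pq; apply: nOq1; rewrite -pq.
exists e => // a b beta [cb ab] ba nUb.
have nOb : ~ O (beta b) by move=> /OK/KW[].
(* Up to the exit time the path stays in [K], hence in [V], where [d] is bounded by the null
   length. *)
have [|t [tab nOt clt below]] := first_exit oO (causal_on_le ab) cb _ nOb.
  by rewrite ba.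
move: tab; rewrite in_itv/= => /andP[at_ tb].
have Kt := cOK _ clt.
apply: le_trans (eS (beta t) (conj Kt nOt)) _.
rewrite -ba (null_length_additive tau_time ab at_ tb).
apply: ler_wpDr; first exact: null_length_ge0.
apply: dist_le_null_length dV dtau (causal_on_restrict ab _ at_ tb) _ => //.
move=> s as_; rewrite le_eqVlt => /predU1P[->|st].
  exact: nbhs_singleton (KV _ Kt).
exact: nbhs_singleton (KV _ (OK _ (below s as_ st))).
Qed.

End exit.

(** * The null distance as a metric, and the length structure *)

Section null_distance.
Context {R : realType} {n : nat} {M : topologicalType} (S : @spacetime R n M).
Context (tau : M -> R) (tau_time : time_function S tau).
Implicit Types (a b c : R) (beta gamma : R -> M) (p q : M).

Lemma piecewise_causal_reparam a b c d beta phi :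
  piecewise_causal S a b beta -> itv_diffeo c d a b phi ->
  piecewise_causal S c d (beta \o phi).
Proof.
move=> [cb ab] cdphi; split; last exact: (causal_reparam tau_time cdphi ab).1.
apply: (@continuous_within_comp R M `[c, d] `[a, b] phi beta) => //.
  by move=> t; have [_ [psi _ [+ _ _ _]]] := cdphi; exact.
exact: itv_diffeo_continuous cdphi.
Qed.

Lemma null_length_reparam a b c d beta phi : itv_diffeo c d a b phi ->
  piecewise_causal S a b beta ->
  null_length S tau c d (beta \o phi) = null_length S tau a b beta.
Proof.
move=> cdphi [_ ab]; have [cd tvE] := causal_reparam tau_time cdphi ab.
by apply: EFin_inj; rewrite !null_length_total_variation.
Qed.

(** The real-valued form of the set in [null_distance], so that infima can be handled in the
    reals. *)
Definition null_lengths p q : set R := [set l | exists a b beta,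
  [/\ piecewise_causal S a b beta, beta a = p, beta b = q &
      l = null_length S tau a b beta]].

Lemma null_lengths_ge0 p q : lbound (null_lengths p q) 0.
Proof. by move=> _ [a [b [beta [_ _ _ ->]]]]; exact: null_length_ge0. Qed.

Lemma piecewise_causal_cst (a : R) p : piecewise_causal S a a (fun=> p).
Proof.
by split; [move=> x; exact: cvg_cst|exact: causal_on_refl].
Qed.

Lemma null_lengths_refl p : null_lengths p p 0.
Proof.
exists 0, 0, (fun=> p); split => //; first exact: piecewise_causal_cst.
apply: EFin_inj; rewrite null_length_total_variation//.
  by rewrite total_variationxx.
exact: causal_on_refl.
Qed.

Lemma null_lengths_sym p q l : null_lengths p q l -> null_lengths q p l.
Proof.
move=> [a [b [beta [cb <- <- ->]]]].
have ab := itv_diffeo_reverse a b.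
exists a, b, (beta \o (fun t => (a + b) + t * -1)); split.
- exact: piecewise_causal_reparam ab.
- by rewrite /= mulrN1 addrAC subrr add0r.
- by rewrite /= mulrN1 addrK.
- by rewrite (null_length_reparam ab).
Qed.

Lemma null_lengths_cat p q r l m :
  null_lengths p q l -> null_lengths q r m -> null_lengths p r (l + m).
Proof.
move=> [a [b [beta [cb <- <- ->]]]] [c [d [gamma [cg gc <- ->]]]].
(* The second path is shifted to start at time [b], where the first one ends. *)
pose phi t := (c - b) + t * 1.
have dphi : itv_diffeo b (d - c + b) c d phi := itv_diffeo_shift c d b.
have cgp := piecewise_causal_reparam cg dphi.
have bgb : beta b = (gamma \o phi) b by rewrite /= /phi mulr1 subrK gc.
have gd : gamma d = (gamma \o phi) (d - c + b).
  by rewrite /= /phi; congr gamma; ring.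
have ab := causal_on_le cb.2; have bd := causal_on_le cgp.2.
have cc := piecewise_causal_concat cb cgp bgb.
exists a, (d - c + b), (concat_path b beta (gamma \o phi)); split => //.
- by rewrite /concat_path ab.
- rewrite -(concat_pathr (b := d - c + b) bgb) ?gd//.
  by rewrite in_itv/= bd lexx.
- rewrite (null_length_additive tau_time cc.2 ab bd).
  rewrite -(null_length_ext tau_time cb.2 (@concat_pathl _ _ _ _ _ _)).
  rewrite -(null_length_ext tau_time cgp.2 (concat_pathr bgb)).
  by rewrite (null_length_reparam dphi).
Qed.

Lemma null_lengths_future a b gamma : future_causal S a b gamma ->
  null_lengths (gamma a) (gamma b) !=set0.
Proof.
move=> fg; exists (null_length S tau a b gamma), a, b, gamma; split => //.
by split; [exact: directed_continuous fg|apply: causal_on_piece; left].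
Qed.

(** The set of points joined to [p] is nonempty, open and closed, hence everything by
    connectedness. *)
Lemma null_lengths_neq0 p q : null_lengths p q !=set0.
Proof.
have cat p1 p2 p3 : null_lengths p1 p2 !=set0 -> null_lengths p2 p3 !=set0 ->
    null_lengths p1 p3 !=set0.
  by move=> [l pl] [m lm]; exists (l + m); exact: null_lengths_cat pl lm.
have sym p1 p2 : null_lengths p1 p2 !=set0 -> null_lengths p2 p1 !=set0.
  by move=> [l pl]; exists l; exact: null_lengths_sym.
(* A common predecessor [x] reaches [p1] itself as well as all points near it: go back from [p1] to
   [x], then forward to [p2]. *)
have near p1 : \forall p2 \near p1, null_lengths p1 p2 !=set0.
  have [x _ px] := common_past S (filterT : nbhs p1 setT).
  have [a [b [g [fg ga gb]]]] := nbhs_singleton px.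
  apply: filterS px => p2 [a' [b' [g' [fg' ga' gb']]]].
  apply: (cat _ x).
    by apply: sym; rewrite -ga -gb; exact: null_lengths_future fg.
  by rewrite -ga' -gb'; exact: null_lengths_future fg'.
pose J := [set q | null_lengths p q !=set0].
have oJ : open J.
  by rewrite openE => p1 pp1; apply: filterS (near p1) => p2; exact: cat.
have cJ : closed J.
  move=> p1 /(_ _ (near p1))[p2 [pp2 p12]].
  by apply: cat pp2 _; exact: sym.
suff JT : J = setT by have : J q by rewrite JT.
apply: (spacetime_connected S).
- by exists p, 0; exact: null_lengths_refl.
- by exists J; rewrite ?setTI.
- by exists J; rewrite ?setTI.
Qed.

Lemma null_distanceE p q :
  null_distance S tau p q = (inf (null_lengths p q))%:E.
Proof.
rewrite -ereal_inf_EFin; last exact: null_lengths_neq0.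
  rewrite /null_distance; congr ereal_inf; apply/seteqP; split => l.
    move=> [a [b [beta [cb ba bb ->]]]].
    by exists (null_length S tau a b beta) => //; exists a, b, beta.
  by move=> [_ [a [b [beta [cb ba bb ->]]]] <-]; exists a, b, beta.
by exists 0; exact: null_lengths_ge0.
Qed.

Lemma null_distance_distance (tau_anti : locally_anti_lipschitz S tau) :
  distance_on [set: M] (fun p q => fine (null_distance S tau p q)).
Proof.
have infle p q l : null_lengths p q l -> inf (null_lengths p q) <= l.
  by apply: ge_inf; exists 0; exact: null_lengths_ge0.
have leinf p q l : lbound (null_lengths p q) l -> l <= inf (null_lengths p q).
  by apply: lb_le_inf; exact: null_lengths_neq0.
split=> [p q _ _|p q _ _|p q _ _|p q r _ _ _]; rewrite !null_distanceE/=.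
- by apply: (leinf); exact: null_lengths_ge0.
- split=> [pq0|->]; last first.
    apply/le_anti; rewrite infle ?leinf//; last exact: null_lengths_refl.
    exact: null_lengths_ge0.
  apply: contrapT => pq.
  (* Definiteness: a path from [p] to [q] leaves this neighborhood of [p], so all lengths are
     bounded below by a positive constant. *)
  have nU : nbhs p (~` [set q]).
    apply: open_nbhs_nbhs; split; last by [].
    apply: closed_openC; apply: accessible_closed_set1.
    exact: hausdorff_accessible (spacetime_hausdorff S).
  have [e e0 eP] := null_length_exit tau_time tau_anti nU.
  suff : e <= inf (null_lengths p q) by rewrite pq0 leNgt e0.
  apply: (leinf) => _ [a [b [beta [cb ba bb ->]]]].
  by apply: eP cb ba _ => /=; rewrite bb; apply.
- apply/le_anti/andP; split; apply: (leinf) => l /null_lengths_sym;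
  exact: infle.
(* The two infima on the right are treated one after the other, which leaves a concatenation of two
   given paths. *)
- rewrite -lerBlDr; apply: (leinf) => l pl.
  rewrite lerBlDr -lerBlDl; apply: (leinf) => m lm.
  by rewrite lerBlDl; apply: (infle); exact: null_lengths_cat pl lm.
Qed.

Lemma null_length_structure (tau_anti : locally_anti_lipschitz S tau) :
  length_structure (piecewise_causal S)
    (fun a b beta => (null_length S tau a b beta)%:E).
Proof.
split.
- split.
  + by move=> a b beta [_ /causal_on_le].
  + by move=> a b beta [].
  + move=> a b beta gamma bg [cb ab]; split; last exact: causal_on_ext bg ab.
    by apply: subspace_eq_continuous cb => t; rewrite inE/= => /bg.
  + move=> a b c d beta [cb ab] ac cd db; split.
      apply: continuous_subspaceW cb => t /=; rewrite !in_itv/= => /andP[ct td].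
      by rewrite (le_trans ac ct) (le_trans td db).
    exact: causal_on_restrict ab ac cd db.
  + exact: piecewise_causal_concat.
  + by move=> a b c d beta phi; exact: piecewise_causal_reparam.
- by move=> a b beta gamma [_ ab] bg; rewrite (null_length_ext tau_time ab bg).
- by move=> a b beta _; rewrite lee_fin null_length_ge0.
- move=> a b c beta [_ ab]; rewrite in_itv/= => /andP[ac cb].
  by rewrite (null_length_additive tau_time ab ac cb).
- by move=> a b beta; exact: null_length_continuous.
- by move=> a b c d beta phi cdphi cb _; rewrite (null_length_reparam cdphi cb).
- move=> p U pU; have [e e0 eP] := null_length_exit tau_time tau_anti pU.
  apply: (@lt_le_trans _ _ e%:E); first by rewrite lte_fin.
  apply/ereal_infP => _ [a [b [beta [cb ba nUb ->]]]].
  by rewrite lee_fin; exact: eP cb ba nUb.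
Qed.

End null_distance.

Theorem theorem1p1 (R : realType) (n : nat) (M : topologicalType)
    (S : @spacetime R n M) (tau : M -> R)
    (tau_time : time_function S tau)
    (tau_anti : locally_anti_lipschitz S tau) :
  [/\ length_structure (piecewise_causal S)
        (fun a b beta => (null_length S tau a b beta)%:E),
      forall p q, null_distance S tau p q =
        intrinsic_metric (piecewise_causal S)
          (fun a b beta => (null_length S tau a b beta)%:E) p q,
      forall p q, null_distance S tau p q \is a fin_num &
      length_space (fun p q => fine (null_distance S tau p q))].
Proof.
have LS := null_length_structure tau_time tau_anti.
have fin p q : null_distance S tau p q \is a fin_num.
  by rewrite (null_distanceE tau_time).
(* The null distance unfolds to the intrinsic metric of the null length, so the second clause is a
   mere conversion. *)
split=> //; split; first exact: null_distance_distance.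
exists (piecewise_causal S), (fun a b beta => (null_length S tau a b beta)%:E).
by split=> // p q; rewrite fineK.
Qed.
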